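(* If $H$ is a cocommutative Hopf algebra over a field $k$, then $S(t_H)_\Theta$ is faithfully flat over $\mathcal{B}_H$.
   Context: $k$ is a field; algebras are associative unital $k$-algebras, coalgebras are coassociative counital $k$-coalgebras, and $\otimes=\otimes_k$. Sweedler notation without summation sign: $\Delta(x)=x_1\otimes x_2$, $\Delta^{(2)}(x)=x_1\otimes x_2\otimes x_3$, etc.; $\varepsilon$ is the counit. Let $H$ be a Hopf algebra over $k$. Let $t_H$ be a copy of the underlying vector space of $H$, with identity map $H\to t_H$ written $x\mapsto t_x$, and let $S(t_H)$ be the symmetric algebra of $t_H$. There is a unique linear map $x\mapsto t^{-1}_x$ from $H$ to the field of fractions $\mathrm{Frac}\,S(t_H)$ such that $t_{x_1}t^{-1}_{x_2}=t^{-1}_{x_1}t_{x_2}=\varepsilon(x)1$ for all $x\in H$. $S(t_H)_\Theta$ denotes the subalgebra of $\mathrm{Frac}\,S(t_H)$ generated by all $t_x$ and $t_x^{-1}$ ($x\in H$). For $x,y\in H$ put $\sigma(x,y)=t_{x_1}t_{y_1}t^{-1}_{x_2y_2}$ and $\sigma^{-1}(x,y)=t_{x_1y_1}t^{-1}_{x_2}t^{-1}_{y_2}$ in $S(t_H)_\Theta$. $\mathcal{B}_H$ denotes the subalgebra of $S(t_H)_\Theta$ generated by all $\sigma(x,y)$ and $\sigma^{-1}(x,y)$, $x,y\in H$; $S(t_H)_\Theta$ is regarded as a $\mathcal{B}_H$-module by multiplication. *)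

(* Defs.v *)
From HB Require Import structures.
From mathcomp Require Import all_boot all_order all_algebra.
From mathcomp Require Import generic_quotient.
From mathcomp Require Import boolp classical_sets.
From mathcomp Require mpoly.
Import (canonicals, coercions) mpoly.

Set Implicit Arguments.
Unset Strict Implicit.
Unset Printing Implicit Defensive.

Import GRing.Theory.
Local Open Scope ring_scope.
Local Open Scope quotient_scope.

Definition is_linear (R : pzRingType) (M N : lmodType R) (f : M -> N) : Prop :=
  forall a u v, f (a *: u + v) = a *: f u + f v.

Definition is_bilinear (R : pzRingType) (M N P : lmodType R)
    (F : M -> N -> P) : Prop :=
  (forall y, is_linear (F ^~ y)) /\ (forall x, is_linear (F x)).

(** [tensor M N] is the set of formal sums of pairs, two formal sums being
    identified when no bilinear map distinguishes them; [tlift_linear],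
    [tlift_pure] and [tensor_ext] are its universal property. *)

Section Tensor.
Variables (R : comNzRingType) (M N : lmodType R).

Definition fsum (P : nmodType) (F : M -> N -> P) (s : seq (M * N)) : P :=
  \sum_(p <- s) F p.1 p.2.

Definition tensor_eqv : rel (seq (M * N)) := fun s s' =>
  `[< forall (P : lmodType R) (F : M -> N -> P),
        is_bilinear F -> fsum F s = fsum F s' >].

Lemma tensor_eqv_refl : reflexive tensor_eqv.
Proof. by move=> s; apply/asboolP. Qed.

Lemma tensor_eqv_sym : symmetric tensor_eqv.
Proof.
by move=> s s'; apply/asboolP/asboolP => e P F bF; rewrite (e P F bF).
Qed.

Lemma tensor_eqv_trans : transitive tensor_eqv.
Proof.
move=> s2 s1 s3 /asboolP e12 /asboolP e23; apply/asboolP => P F bF.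
by rewrite (e12 P F bF) (e23 P F bF).
Qed.

Canonical tensor_equiv :=
  EquivRel tensor_eqv tensor_eqv_refl tensor_eqv_sym tensor_eqv_trans.

Definition tensor := {eq_quot tensor_equiv}.
HB.instance Definition _ := EqQuotient.on tensor.
HB.instance Definition _ := Choice.on tensor.

Lemma tensorP (s s' : seq (M * N)) :
  (forall (P : lmodType R) (F : M -> N -> P),
     is_bilinear F -> fsum F s = fsum F s') <->
  \pi_tensor s = \pi_tensor s'.
Proof.
split=> [e|/eqquotP /asboolP //].
by apply/eqquotP/asboolP.
Qed.

Definition pure (x : M) (y : N) : tensor := \pi_tensor [:: (x, y)].

(** Sweedler notation: for bilinear [F] and [u = \sum_i x_i (x) y_i],
    [tlift F u] is [\sum_i F x_i y_i]; it is computed on a chosen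
    representative and is only meaningful when [F] is bilinear. *)
Definition tlift (P : nmodType) (F : M -> N -> P) (u : tensor) : P :=
  fsum F (repr u).

Lemma tlift_pi (P : lmodType R) (F : M -> N -> P) s :
  is_bilinear F -> tlift F (\pi_tensor s) = fsum F s.
Proof.
by move=> bF; apply: (proj2 (tensorP _ _)) bF; rewrite reprK.
Qed.

Definition tadd (u v : tensor) : tensor := \pi_tensor (repr u ++ repr v).
Definition tscale (a : R) (u : tensor) : tensor :=
  \pi_tensor [seq (a *: p.1, p.2) | p <- repr u].
Definition topp (u : tensor) : tensor := tscale (-1) u.
Definition tzero : tensor := \pi_tensor [::].

Lemma fsum_cat (P : nmodType) (F : M -> N -> P) s s' :
  fsum F (s ++ s') = fsum F s + fsum F s'.
Proof. exact: big_cat. Qed.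

Lemma bilinearZl (P : lmodType R) (F : M -> N -> P) a x y :
  is_bilinear F -> F (a *: x) y = a *: F x y.
Proof.
move=> [l _].
have F0 : F 0 y = 0.
  by apply: (addrI (F 0 y)); rewrite -{1}[F 0 y]scale1r -l scaler0 !addr0.
by have := l y a x 0; rewrite addr0 F0 addr0.
Qed.

Lemma fsum_scale (P : lmodType R) (F : M -> N -> P) a s : is_bilinear F ->
  fsum F [seq (a *: p.1, p.2) | p <- s] = a *: fsum F s.
Proof.
move=> bF; rewrite /fsum big_map scaler_sumr.
by apply: eq_bigr => p _ /=; rewrite bilinearZl.
Qed.

Lemma tensor_extF (u v : tensor) :
  (forall (P : lmodType R) (F : M -> N -> P),
     is_bilinear F -> tlift F u = tlift F v) -> u = v.
Proof.
by move=> e; rewrite -[u]reprK -[v]reprK; apply/tensorP => P F /e.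
Qed.

Lemma tlift_add (P : lmodType R) (F : M -> N -> P) u v : is_bilinear F ->
  tlift F (tadd u v) = tlift F u + tlift F v.
Proof. by move=> bF; rewrite tlift_pi // fsum_cat. Qed.

Lemma tlift_scale (P : lmodType R) (F : M -> N -> P) a u : is_bilinear F ->
  tlift F (tscale a u) = a *: tlift F u.
Proof. by move=> bF; rewrite tlift_pi // fsum_scale. Qed.

Lemma tlift_zero (P : lmodType R) (F : M -> N -> P) : is_bilinear F ->
  tlift F tzero = 0.
Proof. by move=> bF; rewrite tlift_pi // /fsum big_nil. Qed.

Lemma taddA : associative tadd.
Proof.
by move=> u v w; apply: tensor_extF => P F bF; rewrite !tlift_add // addrA.
Qed.
Lemma taddC : commutative tadd.
Proof.
by move=> u v; apply: tensor_extF => P F bF; rewrite !tlift_add // addrC.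
Qed.
Lemma tadd0 : left_id tzero tadd.
Proof.
move=> u; apply: tensor_extF => P F bF.
by rewrite tlift_add // tlift_zero // add0r.
Qed.
Lemma taddN : left_inverse tzero topp tadd.
Proof.
move=> u; apply: tensor_extF => P F bF.
by rewrite tlift_add // tlift_scale // tlift_zero // scaleN1r addNr.
Qed.

HB.instance Definition _ := GRing.isZmodule.Build tensor taddA taddC tadd0 taddN.

Lemma tscaleA a b u : tscale a (tscale b u) = tscale (a * b) u.
Proof.
by apply: tensor_extF => P F bF; rewrite !tlift_scale // scalerA.
Qed.
Lemma tscale1 : left_id 1 tscale.
Proof.
by move=> u; apply: tensor_extF => P F bF; rewrite !tlift_scale // scale1r.
Qed.
Lemma tscaleDr : right_distributive tscale tadd.
Proof.
move=> a u v; apply: tensor_extF => P F bF.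
by rewrite tlift_scale // !tlift_add // !tlift_scale // scalerDr.
Qed.
Lemma tscaleDl u : {morph tscale^~ u : a b / a + b >-> tadd a b}.
Proof.
move=> a b; apply: tensor_extF => P F bF.
by rewrite tlift_add // !tlift_scale // scalerDl.
Qed.

HB.instance Definition _ :=
  GRing.Zmodule_isLmodule.Build R tensor tscaleA tscale1 tscaleDr tscaleDl.

Lemma pure_bilinear : is_bilinear pure.
Proof.
split=> [y a u v|x a u v]; apply: tensor_extF => P F bF.
  rewrite tlift_add // tlift_scale // !tlift_pi // /fsum !big_seq1 /=.
  by case: bF => l _; apply: l.
rewrite tlift_add // tlift_scale // !tlift_pi // /fsum !big_seq1 /=.
by case: bF => _ r; apply: r.
Qed.

Lemma tlift_pure (P : lmodType R) (F : M -> N -> P) x y :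
  is_bilinear F -> tlift F (pure x y) = F x y.
Proof. by move=> bF; rewrite tlift_pi // /fsum big_seq1. Qed.

Lemma tlift_linear (P : lmodType R) (F : M -> N -> P) :
  is_bilinear F -> is_linear (tlift F).
Proof.
by move=> bF a u v; rewrite [LHS]tlift_add // [X in X + _]tlift_scale.
Qed.

Lemma tensorE (u : tensor) : u = \sum_(p <- repr u) pure p.1 p.2.
Proof.
rewrite -{1}[u]reprK; elim: (repr u) => [|[x y] s IHs].
  by rewrite big_nil.
rewrite big_cons -IHs; apply: tensor_extF => P F bF.
by rewrite tlift_add // !tlift_pi // /fsum big_cons big_seq1.
Qed.

Lemma tensor_ext (P : lmodType R) (f g : {linear tensor -> P}) :
  (forall x y, f (pure x y) = g (pure x y)) -> f =1 g.
Proof.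
by move=> e u; rewrite [u]tensorE !raddf_sum; apply: eq_bigr => p _; apply: e.
Qed.

End Tensor.

Arguments tensor {R} M N.
Arguments pure {R M N} x y.
Notation "M \ox N" := (tensor M N) (at level 40, left associativity) : type_scope.
Notation "x \ot y" := (pure x y) (at level 40, left associativity) : ring_scope.

Definition tmap (R : comNzRingType) (M N M' N' : lmodType R)
    (f : M -> M') (g : N -> N') : (M \ox N)%type -> (M' \ox N')%type :=
  tlift (fun x y => f x \ot g y).

Definition exact (R : pzRingType) (X Y Z : lmodType R)
    (f : X -> Y) (g : Y -> Z) : Prop :=
  forall y, g y = 0 <-> exists x, f x = y.

Definition faithfully_flat (R : comNzRingType) (M : lmodType R) : Prop :=
  forall (X Y Z : lmodType R) (f : {linear X -> Y}) (g : {linear Y -> Z}),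
    exact f g <-> exact (tmap (@id M) f) (tmap (@id M) g).

Section Structures.
Variables (R : comNzRingType) (C : lmodType R).

Definition tswap : (C \ox C)%type -> (C \ox C)%type := tlift (fun x y => y \ot x).
Definition tassoc : ((C \ox C) \ox C)%type -> (C \ox (C \ox C))%type :=
  tlift (fun u z => tlift (fun x y => x \ot (y \ot z)) u).

End Structures.

Definition tmul (R : comNzRingType) (A : algType R) (u v : (A \ox A)%type) :
    (A \ox A)%type :=
  tlift (fun a b => tlift (fun c d => (a * c) \ot (b * d)) v) u.

HB.mixin Record Lmodule_isCoalgebra (R : comNzRingType) C
    of GRing.Lmodule R C := {
  comul : {linear C -> (C \ox C)%type};
  counit : {linear C -> R^o};
  comulA : forall x,
    tassoc (tmap comul id (comul x)) = tmap id comul (comul x);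
  counitl : forall x, tlift (fun x1 x2 => counit x1 *: x2) (comul x) = x;
  counitr : forall x, tlift (fun x1 x2 => counit x2 *: x1) (comul x) = x
}.

#[short(type="coalgType")]
HB.structure Definition Coalgebra (R : comNzRingType) :=
  { C of Lmodule_isCoalgebra R C & GRing.Lmodule R C }.

HB.mixin Record Coalgebra_isHopfAlgebra (R : comNzRingType) H
    of GRing.Algebra R H & Coalgebra R H := {
  comul1 : comul (1 : H) = 1 \ot 1;
  comulM : forall x y : H, comul (x * y) = tmul (comul x) (comul y);
  counit1 : counit (1 : H) = 1;
  counitM : forall x y : H, counit (x * y) = counit x * counit y;
  antipode : {linear H -> H};
  antipodel : forall x : H,
    tlift (fun x1 x2 => antipode x1 * x2) (comul x) = (counit x)%:A;
  antipoder : forall x : H,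
    tlift (fun x1 x2 => x1 * antipode x2) (comul x) = (counit x)%:A
}.

#[short(type="hopfAlgType")]
HB.structure Definition HopfAlgebra (R : comNzRingType) :=
  { H of Coalgebra_isHopfAlgebra R H & GRing.Algebra R H & Coalgebra R H }.

Definition cocommutative (R : comNzRingType) (C : coalgType R) : Prop :=
  forall x : C, tswap (comul x) = comul x.

(** [sweedler x F] is [F x_1 x_2] in Sweedler notation; as for [tlift], [F]
    must be bilinear. *)
Definition sweedler (R : comNzRingType) (C : coalgType R) (P : nmodType)
    (x : C) (F : C -> C -> P) : P :=
  tlift F (comul x).

(** [Sym V] is the set of formal linear combinations of words in [V], two
    combinations being identified when they have the same value under every
    linear map from [V] to a commutative algebra; [sym_lift] and [sym_ext] are
    its universal property. *)

Section SymDef.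
Variables (k : fieldType) (V : lmodType k).

Definition sym_eval (B : comAlgType k) (f : V -> B) (s : seq (k * seq V)) : B :=
  \sum_(p <- s) p.1 *: \prod_(v <- p.2) f v.

Definition sym_eqv : rel (seq (k * seq V)) := fun s s' =>
  `[< forall (B : comAlgType k) (f : V -> B),
        is_linear f -> sym_eval f s = sym_eval f s' >].

Lemma sym_eqv_refl : reflexive sym_eqv.
Proof. by move=> s; apply/asboolP. Qed.

Lemma sym_eqv_sym : symmetric sym_eqv.
Proof.
by move=> s s'; apply/asboolP/asboolP => e B f lf; rewrite (e B f lf).
Qed.

Lemma sym_eqv_trans : transitive sym_eqv.
Proof.
move=> s2 s1 s3 /asboolP e12 /asboolP e23; apply/asboolP => B f lf.
by rewrite (e12 B f lf) (e23 B f lf).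
Qed.

Canonical sym_equiv := EquivRel sym_eqv sym_eqv_refl sym_eqv_sym sym_eqv_trans.

Definition Sym := {eq_quot sym_equiv}.
HB.instance Definition _ := EqQuotient.on Sym.
HB.instance Definition _ := Choice.on Sym.

Definition sym_lift (B : comAlgType k) (f : V -> B) (p : Sym) : B :=
  sym_eval f (repr p).

Lemma sym_lift_pi (B : comAlgType k) (f : V -> B) s :
  is_linear f -> sym_lift f (\pi_Sym s) = sym_eval f s.
Proof.
move=> lf; have /eqquotP /asboolP e : \pi_Sym (repr (\pi_Sym s)) = \pi_Sym s.
  by rewrite reprK.
exact: e.
Qed.

Lemma sym_extF (p q : Sym) :
  (forall (B : comAlgType k) (f : V -> B),
     is_linear f -> sym_lift f p = sym_lift f q) -> p = q.
Proof.
move=> e; rewrite -[p]reprK -[q]reprK; apply/eqquotP/asboolP => B f lf.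
exact: e.
Qed.

Definition sadd (p q : Sym) : Sym := \pi_Sym (repr p ++ repr q).
Definition sscale (a : k) (p : Sym) : Sym :=
  \pi_Sym [seq (a * m.1, m.2) | m <- repr p].
Definition sopp (p : Sym) : Sym := sscale (-1) p.
Definition szero : Sym := \pi_Sym [::].
Definition sone : Sym := \pi_Sym [:: (1, [::])].
Definition smul (p q : Sym) : Sym :=
  \pi_Sym [seq (m.1 * n.1, m.2 ++ n.2) | m <- repr p, n <- repr q].
Definition sgen (v : V) : Sym := \pi_Sym [:: (1, [:: v])].

Section Lift.
Variables (B : comAlgType k) (f : V -> B).
Hypothesis lf : is_linear f.

Lemma sym_liftD p q : sym_lift f (sadd p q) = sym_lift f p + sym_lift f q.
Proof. by rewrite sym_lift_pi // /sym_eval big_cat. Qed.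

Lemma sym_liftZ a p : sym_lift f (sscale a p) = a *: sym_lift f p.
Proof.
rewrite sym_lift_pi // /sym_lift /sym_eval big_map scaler_sumr.
by apply: eq_bigr => m _ /=; rewrite scalerA.
Qed.

Lemma sym_lift0 : sym_lift f szero = 0.
Proof. by rewrite sym_lift_pi // /sym_eval big_nil. Qed.

Lemma sym_lift1 : sym_lift f sone = 1.
Proof. by rewrite sym_lift_pi // /sym_eval big_seq1 /= big_nil scale1r. Qed.

Lemma sym_liftM p q : sym_lift f (smul p q) = sym_lift f p * sym_lift f q.
Proof.
rewrite sym_lift_pi // /sym_lift /sym_eval big_allpairs_dep /= mulr_suml.
apply: eq_bigr => m _; rewrite mulr_sumr; apply: eq_bigr => n _ /=.
by rewrite big_cat /= -scalerAl -scalerAr scalerA.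
Qed.

Lemma sym_lift_gen v : sym_lift f (sgen v) = f v.
Proof. by rewrite sym_lift_pi // /sym_eval big_seq1 /= big_seq1 scale1r. Qed.

Definition sym_liftE :=
  (sym_liftD, sym_liftZ, sym_lift0, sym_lift1, sym_liftM, sym_lift_gen).
End Lift.

Local Ltac sym := let lf := fresh "lf" in
  move=> *; apply: sym_extF => ? ? lf; rewrite !(sym_liftE lf).

Lemma saddA : associative sadd. Proof. by sym; rewrite addrA. Qed.
Lemma saddC : commutative sadd. Proof. by sym; rewrite addrC. Qed.
Lemma sadd0 : left_id szero sadd. Proof. by sym; rewrite add0r. Qed.
Lemma saddN : left_inverse szero sopp sadd.
Proof. by sym; rewrite scaleN1r addNr. Qed.
HB.instance Definition _ := GRing.isZmodule.Build Sym saddA saddC sadd0 saddN.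

Lemma smulA : associative smul. Proof. by sym; rewrite mulrA. Qed.
Lemma smulC : commutative smul. Proof. by sym; rewrite mulrC. Qed.
Lemma smul1 : left_id sone smul. Proof. by sym; rewrite mul1r. Qed.
Lemma smulDl : left_distributive smul sadd. Proof. by sym; rewrite mulrDl. Qed.
Lemma sone_neq0 : sone != szero.
Proof.
have l0 : is_linear (fun _ : V => 0 : k^o).
  by move=> a u v; rewrite scaler0 addr0.
by apply: contra_neq (oner_neq0 k) => e; rewrite -(sym_lift1 l0) e sym_lift0.
Qed.
HB.instance Definition _ :=
  GRing.Zmodule_isComNzRing.Build Sym smulA smulC smul1 smulDl sone_neq0.

Lemma sscaleA a b p : sscale a (sscale b p) = sscale (a * b) p.
Proof. by sym; rewrite scalerA. Qed.
Lemma sscale1 : left_id 1 sscale. Proof. by sym; rewrite scale1r. Qed.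
Lemma sscaleDr : right_distributive sscale sadd.
Proof. by sym; rewrite scalerDr. Qed.
Lemma sscaleDl p : {morph sscale^~ p : a b / a + b >-> sadd a b}.
Proof. by sym; rewrite scalerDl. Qed.
HB.instance Definition _ :=
  GRing.Zmodule_isLmodule.Build k Sym sscaleA sscale1 sscaleDr sscaleDl.

Lemma sscaleAl a p q : sscale a (smul p q) = smul (sscale a p) q.
Proof. by sym; rewrite scalerAl. Qed.
Lemma sscaleAr a p q : sscale a (smul p q) = smul p (sscale a q).
Proof. by sym; rewrite scalerAr. Qed.
HB.instance Definition _ := GRing.Lmodule_isLalgebra.Build k Sym sscaleAl.
HB.instance Definition _ := GRing.Lalgebra_isAlgebra.Build k Sym sscaleAr.

Lemma sgen_linear : is_linear sgen.
Proof.
move=> a u v; apply: sym_extF => B f lf.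
by rewrite !(sym_liftE lf); apply: lf.
Qed.
HB.instance Definition _ := GRing.isLinear.Build k V Sym *:%R sgen sgen_linear.

Lemma sym_liftP (B : comAlgType k) (f : V -> B) : is_linear f ->
  [/\ is_linear (sym_lift f), monoid_morphism (sym_lift f)
    & forall v, sym_lift f (sgen v) = f v].
Proof.
move=> lf; split; last exact: sym_lift_gen.
- by move=> a p q; rewrite [LHS]sym_liftD // [X in X + _]sym_liftZ.
- by split=> [|p q]; [apply: sym_lift1 | apply: sym_liftM].
Qed.

Lemma SymE (p : Sym) :
  p = \sum_(m <- repr p) m.1 *: \prod_(v <- m.2) sgen v.
Proof.
apply: sym_extF => B f lf; have [lin [lift1 liftM] liftg] := sym_liftP lf.
rewrite -{1}[p]reprK sym_lift_pi // /sym_eval.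
elim: (repr p) => [|[a w] s IHs]; first by rewrite !big_nil sym_lift0.
rewrite !big_cons lin IHs /=; congr (_ *: _ + _).
elim: w => [|v w IHw]; first by rewrite !big_nil lift1.
by rewrite !big_cons liftM IHw liftg.
Qed.

Lemma sym_ext (B : comAlgType k) (f g : {lrmorphism Sym -> B}) :
  (forall v, f (sgen v) = g (sgen v)) -> f =1 g.
Proof.
move=> e p; rewrite [p]SymE !linear_sum; apply: eq_bigr => m _.
rewrite !linearZ_LR !rmorph_prod; congr (_ *: _).
by apply: eq_bigr => v _; exact: e.
Qed.

End SymDef.

Section SeparatingForm.
Variables (k : fieldType) (V : lmodType k) (w : V).
Hypothesis w_neq0 : w != 0.

Lemma separating_form : exists2 phi : V -> k^o, is_linear phi & phi w = 1.
Proof.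
pose P (A : set V) := (forall a u v, A u -> A v -> A (a *: u + v)) /\ ~ A w.
have [F FP Ftot|A [[Alin Aw] Amax]] := @Zorn_bigcup V P.
  split=> [a u v [X FX Xu] [Y FY Yv]|[X FX Xw]]; last by case: (FP _ FX).
  case: (Ftot _ _ FX FY) => [XY|YX].
    by exists Y => //; apply: (FP _ FY).1 => //; apply: XY.
  by exists X => //; apply: (FP _ FX).1 => //; apply: YX.
have A0 : A 0.
  apply: contrapT => nA0; apply: (Amax [set 0]%classic).
    split=> [u Au|sub]; last by apply: nA0; apply: sub.
    by case: nA0; rewrite -(addNr u) -scaleN1r; apply: Alin.
  split=> [a u v -> ->|/eqP]; first by rewrite scaler0 addr0.
  by rewrite (negPf w_neq0).
have AZ a u : A u -> A (a *: u).
  by move=> Au; rewrite -[_ *: _]addr0; apply: Alin.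
have ex v : exists c, A (v - c *: w).
  have [Av|nAv] := pselect (A v); first by exists 0; rewrite scale0r subr0.
  pose B : set V := fun x => exists a, exists2 u, A u & x = a *: v + u.
  have AB : (A `<` B)%classic.
    split=> [u Au|sub]; first by exists 0; exists u => //; rewrite scale0r add0r.
    by apply/nAv/sub; exists 1; exists 0 => //; rewrite scale1r addr0.
  have [[a [u Au ew]]|nBw] := pselect (B w); last first.
    case: (Amax _ AB); split=> // a _ _ [b [u Au ->]] [c [u' Au' ->]].
    exists (a * b + c); exists (a *: u + u'); first exact: Alin.
    by rewrite scalerDr scalerA scalerDl addrACA.
  have a0 : a != 0.
    by apply/eqP => a0; apply: Aw; rewrite ew a0 scale0r add0r.
  exists a^-1; rewrite ew scalerDr scalerA mulVf // scale1r opprD addNKr.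
  by rewrite -scaleNr; apply: AZ.
have uniq v c d : A (v - c *: w) -> A (v - d *: w) -> c = d.
  move=> Ac Ad; apply/eqP; rewrite -subr_eq0; apply/negPn/negP => cd.
  apply: Aw; rewrite -[w](scalerK cd) scalerBl; apply: AZ.
  have := Alin (-1) _ _ Ac Ad; rewrite scaleN1r opprB addrA subrK.
  exact.
have [phi phiP] := choice ex.
exists phi => [a u v|].
  apply: (uniq (a *: u + v)); first exact: phiP.
  have := Alin a _ _ (phiP u) (phiP v).
  by rewrite scalerBr scalerA addrACA -opprD -scalerDl.
by apply: (uniq w); [apply: phiP | rewrite scale1r subrr].
Qed.

End SeparatingForm.

Section SymDomain.
Variables (k : fieldType) (V : lmodType k).
Implicit Types (vs : seq V) (s : seq (V * (V -> k^o))).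

Let x0 : V * (V -> k^o) := (0, fun=> 0).
Let proj s (v : V) : V := \sum_(p <- s) p.2 v *: p.1.

Let proj_lin s : (forall i, is_linear (nth x0 s i).2) ->
  is_linear (proj s).
Proof.
move=> ls a u v; rewrite /proj scaler_sumr -big_split /=.
rewrite !(big_nth x0); apply: eq_bigr => i _.
by rewrite ls scalerDl scalerA.
Qed.

Lemma finite_proj vs : exists s,
  [/\ forall i, is_linear (nth x0 s i).2,
      forall v, proj s (proj s v) = proj s v
    & {in vs, forall v, proj s v = v}].
Proof.
have lin0 : is_linear ((fun=> 0) : V -> k^o) by move=> *; rewrite scaler0 addr0.
elim: vs => [|v vs [s [ls idem fix_vs]]].
  by exists [::]; split=> // [i|u]; rewrite ?nth_nil // /proj !big_nil.
have lp := proj_lin ls.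
have lpD u u' : proj s (u + u') = proj s u + proj s u'.
  by have := lp 1 u u'; rewrite !scale1r.
have lp0 : proj s 0 = 0.
  by apply: (addrI (proj s 0)); rewrite -lpD !addr0.
have lpZ a u : proj s (a *: u) = a *: proj s u.
  by have := lp a u 0; rewrite lp0 !addr0.
have [e|w0] := eqVneq (v - proj s v) 0.
  exists s; split=> // u; rewrite inE => /predU1P[->|/fix_vs//].
  by apply/esym/eqP; rewrite -subr_eq0 e.
set w := v - proj s v in w0.
have [phi lphi phiw] := separating_form w0.
have phi0 : phi 0 = 0.
  apply: (addrI (phi 0)); rewrite addr0.
  by have := lphi 1 0 0; rewrite !scale1r addr0 => <-.
pose psi u := phi (u - proj s u).
have lpsi : is_linear psi.
  move=> a u u'; rewrite /psi -lphi lp; congr phi.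
  by rewrite scalerBr opprD addrACA.
have pw : proj s w = 0.
  by rewrite /w -scaleN1r lpD lpZ idem scaleN1r subrr.
have psiw : psi w = 1 by rewrite /psi pw subr0.
have psip u : psi (proj s u) = 0 by rewrite /psi idem subrr.
have projE u : proj ((w, psi) :: s) u = psi u *: w + proj s u.
  by rewrite /proj big_cons.
exists ((w, psi) :: s); split=> [[|i] /=|u|u]; [exact: lpsi | exact: ls | |].
  rewrite !projE lpD lpZ pw scaler0 add0r idem.
  by rewrite lpsi psiw psip addr0 [_ *: 1]mulr1.
rewrite projE inE => /predU1P[->|uvs].
  by rewrite [psi v]phiw scale1r subrK.
by rewrite /psi fix_vs // subrr phi0 scale0r add0r.
Qed.

Lemma Sym_idomain_axiom (p q : Sym V) : p * q = 0 -> (p == 0) || (q == 0).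
Proof.
move=> pq0.
pose vs := flatten [seq m.2 | m <- repr p] ++ flatten [seq m.2 | m <- repr q].
have [s [ls _ fix_vs]] := finite_proj vs.
pose n := size s.
pose B := mpoly.mpoly n k.
pose ev (v : V) : B :=
  \sum_(i < n) ((nth x0 s i).2 v : k) *: mpoly.mpolyX k (mpoly.mnm1 i).
have lev : is_linear ev.
  move=> a u v; rewrite /ev scaler_sumr -big_split /=.
  by apply: eq_bigr => i _; rewrite ls scalerDl scalerA.
have [lin [lift1 liftM] liftg] := sym_liftP lev.
pose back : B -> Sym V :=
  mpoly.mmap (GRing.in_alg (Sym V)) (fun i : 'I_n => sgen (nth x0 s i).1).
have backZ a b : back (a *: b) = a *: back b.
  by rewrite /back mpoly.mmapZ /= mulr_algl.
have backg v : v \in vs -> back (sym_lift ev (sgen v)) = sgen v.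
  move=> vvs; rewrite liftg /ev /back raddf_sum -[in RHS](fix_vs v vvs) /=.
  rewrite /proj (big_nth x0) big_mkord linear_sum /=; apply: eq_bigr => i _.
  by rewrite -/back backZ linearZ /= /back mpoly.mmapX mpoly.mmap1U.
have backK (r : Sym V) : {subset flatten [seq m.2 | m <- repr r] <= vs} ->
    back (sym_lift ev r) = r.
  move=> sub; rewrite [in RHS](SymE r) {1}(SymE r).
  elim: (repr r) sub => [|[a u] t IHt] sub.
    by rewrite !big_nil sym_lift0 // /back raddf0.
  rewrite !big_cons lin {1}/back raddfD /= -/back backZ IHt; last first.
    by move=> v vt; apply: sub; rewrite /= mem_cat vt orbT.
  congr (_ *: _ + _).
  have : {subset u <= vs} by move=> v vu; apply: sub; rewrite /= mem_cat vu.
  elim: u {sub} => [|v u IHu] sub.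
    by rewrite !big_nil lift1 /back rmorph1.
  rewrite !big_cons liftM {1}/back rmorphM /= -/back backg ?sub ?mem_head //.
  by rewrite IHu // => x xu; rewrite sub // inE xu orbT.
have : sym_lift ev p * sym_lift ev q = 0.
  by rewrite -liftM pq0; apply: sym_lift0.
move/eqP; rewrite mulf_eq0 => /orP[] /eqP e; apply/orP; [left|right].
  rewrite -(backK p) ?e /back ?raddf0 // => v vp.
  by rewrite mem_cat vp.
rewrite -(backK q) ?e /back ?raddf0 // => v vq.
by rewrite mem_cat vq orbT.
Qed.

End SymDomain.

Section SymUnit.
Variables (k : fieldType) (V : lmodType k).

Definition sunit : pred (Sym V) := fun p => `[< exists q, q * p = 1 >].

Lemma sinv_ex (p : Sym V) : exists q, if sunit p then q * p = 1 else q = p.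
Proof.
by rewrite /sunit; case: asboolP => [[q e]|_]; [exists q | exists p].
Qed.

Definition sinv (p : Sym V) : Sym V := sval (cid (sinv_ex p)).

Lemma smulV : {in sunit, left_inverse 1 sinv *%R}.
Proof.
move=> p up; have {}up : sunit p by [].
by rewrite /sinv; case: cid => q /=; rewrite up.
Qed.

Lemma sunitPl (p q : Sym V) : q * p = 1 -> sunit p.
Proof. by move=> e; apply/asboolP; exists q. Qed.

Lemma sinv_out : {in [predC sunit], sinv =1 id}.
Proof.
move=> p; rewrite inE => np; have {}np : sunit p = false by apply: negPf.
by rewrite /sinv; case: cid => q /=; rewrite np.
Qed.

HB.instance Definition _ := GRing.ComNzRing_hasMulInverse.Build (Sym V)
  smulV sunitPl sinv_out.
HB.instance Definition _ := GRing.ComUnitRing_isIntegral.Build (Sym V)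
  (@Sym_idomain_axiom k V).

End SymUnit.

Section FracSym.
Variables (k : fieldType) (V : lmodType k).

Definition FracSym := {fraction (Sym V)}.
HB.instance Definition _ := GRing.Field.on FracSym.

Definition frac_sym (p : Sym V) : FracSym := tofrac p.
HB.instance Definition _ :=
  GRing.RMorphism.copy frac_sym (@tofrac (Sym V)).

Definition fscale (a : k) (x : FracSym) : FracSym := frac_sym a%:A * x.

Lemma fscaleA a b x : fscale a (fscale b x) = fscale (a * b) x.
Proof. by rewrite /fscale mulrA -rmorphM -scalerAl mul1r scalerA. Qed.
Lemma fscale1 : left_id 1 fscale.
Proof. by move=> x; rewrite /fscale scale1r rmorph1 mul1r. Qed.
Lemma fscaleDr : right_distributive fscale +%R.
Proof. by move=> a x y; rewrite /fscale mulrDr. Qed.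
Lemma fscaleDl x : {morph fscale^~ x : a b / a + b}.
Proof. by move=> a b; rewrite /fscale scalerDl rmorphD mulrDl. Qed.
HB.instance Definition _ :=
  GRing.Zmodule_isLmodule.Build k FracSym fscaleA fscale1 fscaleDr fscaleDl.

Lemma fscaleAl a (x y : FracSym) : a *: (x * y) = (a *: x) * y.
Proof. exact: mulrA. Qed.
Lemma fscaleAr a (x y : FracSym) : a *: (x * y) = x * (a *: y).
Proof. exact: mulrCA. Qed.
HB.instance Definition _ := GRing.Lmodule_isLalgebra.Build k FracSym fscaleAl.
HB.instance Definition _ := GRing.Lalgebra_isAlgebra.Build k FracSym fscaleAr.

Lemma frac_symZ : scalable frac_sym.
Proof. by move=> a p; rewrite -mulr_algl rmorphM. Qed.
HB.instance Definition _ := GRing.isScalable.Build k (Sym V) FracSym *:%R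
  frac_sym frac_symZ.

End FracSym.

Section GeneratedSubalgebra.
Variables (k : fieldType) (A : comAlgType k) (G : A -> Prop).

Definition subalg_gen : {pred A} := fun x =>
  `[< forall S : {pred A}, GRing.subalg_closed S ->
        (forall g, G g -> g \in S) -> x \in S >].

Lemma subalg_gen_closed : GRing.subalg_closed subalg_gen.
Proof.
split; first by apply/asboolP => S [].
  move=> a u v /asboolP Su /asboolP Sv; apply/asboolP => S cS GS.
  by case: (cS) => _ lin _; apply: lin; [apply: Su | apply: Sv].
move=> u v /asboolP Su /asboolP Sv; apply/asboolP => S cS GS.
by case: (cS) => _ _ mul; apply: mul; [apply: Su | apply: Sv].
Qed.

Lemma mem_subalg_gen g : G g -> g \in subalg_gen.
Proof. by move=> Gg; apply/asboolP => S _; apply. Qed.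

HB.instance Definition _ := GRing.isSubalgClosed.Build k A subalg_gen
  subalg_gen_closed.

Definition subalg := {x : A | x \in subalg_gen}.
HB.instance Definition _ := SubChoice.on subalg.
HB.instance Definition _ := [SubChoice_isSubComNzRing of subalg by <:].
HB.instance Definition _ := [SubZmodule_isSubLmodule of subalg by <:].
HB.instance Definition _ := [SubNzRing_SubLmodule_isSubLalgebra of subalg by <:].
HB.instance Definition _ := [SubLalgebra_isSubAlgebra of subalg by <:].

Definition subalg_elt g (Gg : G g) : subalg := exist _ g (mem_subalg_gen Gg).

(** [A] as a module over its subalgebra [subalg], by multiplication. *)
Definition over_subalg (_ : A -> Prop) : Type := A.
HB.instance Definition _ := GRing.Zmodule.on (over_subalg G).

Definition subalg_scale (b : subalg) (x : over_subalg G) : over_subalg G :=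
  (val b : A) * (x : A).

Lemma subalg_scaleA a b x :
  subalg_scale a (subalg_scale b x) = subalg_scale (a * b) x.
Proof. exact: mulrA. Qed.
Lemma subalg_scale1 : left_id 1 subalg_scale.
Proof. exact: mul1r. Qed.
Lemma subalg_scaleDr : right_distributive subalg_scale +%R.
Proof. by move=> b x y; apply: mulrDr. Qed.
Lemma subalg_scaleDl x : {morph subalg_scale^~ x : a b / a + b}.
Proof. by move=> a b; apply: mulrDl. Qed.
HB.instance Definition _ := GRing.Zmodule_isLmodule.Build subalg (over_subalg G)
  subalg_scaleA subalg_scale1 subalg_scaleDr subalg_scaleDl.

End GeneratedSubalgebra.

Section GenericBase.
Variables (k : fieldType) (H : hopfAlgType k).

(** The copy [t_H] of [H] is [H] itself inside [Sym H], so that [t_x] is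
    [sgen x], here in the field of fractions. *)
Definition tgen (x : H) : FracSym H := frac_sym (sgen x).

(** The convolution inverse of [tgen], which determines [tinv] uniquely. *)
Definition is_tgen_inverse (tinv : {linear H -> FracSym H}) : Prop :=
  forall x : H,
    sweedler x (fun x1 x2 => tgen x1 * tinv x2) = (counit x : k)%:A /\
    sweedler x (fun x1 x2 => tinv x1 * tgen x2) = (counit x : k)%:A.

Variable tinv : {linear H -> FracSym H}.

Inductive theta_gen : FracSym H -> Prop :=
  | Theta_t x : theta_gen (tgen x)
  | Theta_tinv x : theta_gen (tinv x).

Definition STheta := subalg theta_gen.
HB.instance Definition _ := GRing.ComAlgebra.on STheta.

Definition t_ (x : H) : STheta := subalg_elt (Theta_t x).
Definition tV_ (x : H) : STheta := subalg_elt (Theta_tinv x).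

Definition sigma (x y : H) : STheta :=
  sweedler x (fun x1 x2 => sweedler y (fun y1 y2 =>
    t_ x1 * t_ y1 * tV_ (x2 * y2))).
Definition sigmaV (x y : H) : STheta :=
  sweedler x (fun x1 x2 => sweedler y (fun y1 y2 =>
    t_ (x1 * y1) * tV_ x2 * tV_ y2)).

Inductive base_gen : STheta -> Prop :=
  | Base_sigma x y : base_gen (sigma x y)
  | Base_sigmaV x y : base_gen (sigmaV x y).

Definition BH := subalg base_gen.
HB.instance Definition _ := GRing.ComAlgebra.on BH.

Definition STheta_over_BH : lmodType BH := over_subalg base_gen.

End GenericBase.

(* Main.v *)
Require Import Defs.
From HB Require Import structures.
From mathcomp Require Import all_boot all_order all_algebra.
From mathcomp Require Import generic_quotient.
From mathcomp Require Import boolp.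
From mathcomp Require functions.
Import (canonicals) functions.

(** Write [A] for [S(t_H)_Theta] and [B] for the base algebra [B_H]. The
    theorem is an instance of Takeuchi's theorem that a commutative Hopf
    algebra is faithfully flat over each of its Hopf subalgebras; it is
    proved here for a commutative Hopf algebra [A] without zero divisors,
    where a short argument is available.

    _The Hopf algebra._ By the fundamental theorem of coalgebras
    ([coalgebra_finiteness]) every element of [H] is a combination of
    entries of matrices [m] with [Delta m_ij = \sum_l m_il (x) m_lj]. For
    such [m] the matrix [(t^-1_(m_ij))] is the inverse of [(t_(m_ij))], so
    that [A] is the localization of the symmetric algebra at the
    determinants of the latter. Hence algebra maps [A -> R] correspond to
    convolution invertible linear maps [H -> R] ([STheta_lift],
    [STheta_ext]): [A] represents an abelian group functor, because [H] is
    cocommutative. Its comultiplication [rho], counit and antipode come from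
    the product, the unit and the inverse of convolution. The cocycle
    [sigma] is the coboundary of [t], and taking coboundaries is
    multiplicative ([cobound_conv]); therefore [rho (sigma (x, y)) = sigma
    (x_1, y_1) (x) sigma (x_2, y_2)], and the antipode exchanges [sigma] and
    [sigma^-1]. So [B] is a Hopf subalgebra.

    _Flatness._ Let [c_1, ..., c_n] be elements of [A], with [1] among them,
    that span a subcomodule: [rho c_j = \sum_i c_i (x) M_ij] with [M]
    invertible. Every finite subset of [A] lies in such a span. Let [N =
    \sum_i B c_i]. The [b] in [B] for which multiplication by [b] on [N]
    factors through a free [B]-module, as [x |-> \sum_j phi_j(x) c_j], form
    an ideal of [B]. It is nonzero because [A] is a domain
    ([splitting_neq0]), and it is stable under the coaction, because the
    [phi_j] can be translated along with [b] ([splitting_stable]). A nonzero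
    stable ideal of [B] contains [1] ([stable_ideal_unit]), so [N] is a
    projective [B]-module. The same argument for the ideal of the values at
    [1] of the linear forms on [N] shows that [1] spans a direct summand of
    [N]. Thus [A] is a directed union of finitely generated projective
    modules split by [1], which is enough for faithful flatness
    ([locally_split_faithfully_flat]). *)

Set Implicit Arguments.
Unset Strict Implicit.
Unset Printing Implicit Defensive.

Import GRing.Theory.
Local Open Scope ring_scope.

(** * Faithful flatness of locally split modules *)

Definition linmap (R : pzRingType) (M N : lmodType R) (f : M -> N)
    (lf : is_linear f) : {linear M -> N} :=
  HB.pack f (GRing.isLinear.Build R M N *:%R f lf).

Arguments linmap : simpl never.

Lemma linear_is_linear (R : pzRingType) (M N : lmodType R)
  (f : {linear M -> N}) : is_linear f.
Proof. by move=> a u v; rewrite linearP. Qed.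

Section PureTensors.
Variables (R : comNzRingType) (V W : lmodType R).

Lemma pureZl (a : R) (x : V) (y : W) : (a *: x) \ot y = a *: (x \ot y).
Proof. exact: (linearZ_LR (linmap ((pure_bilinear V W).1 y))). Qed.
Lemma pureZr (a : R) (x : V) (y : W) : x \ot (a *: y) = a *: (x \ot y).
Proof. exact: (linearZ_LR (linmap ((pure_bilinear V W).2 x))). Qed.
Lemma pureDl (x x' : V) (y : W) : (x + x') \ot y = x \ot y + x' \ot y.
Proof. exact: (raddfD (linmap ((pure_bilinear V W).1 y))). Qed.
Lemma pureDr (x : V) (y y' : W) : x \ot (y + y') = x \ot y + x \ot y'.
Proof. exact: (raddfD (linmap ((pure_bilinear V W).2 x))). Qed.
Lemma pure_suml I (r : seq I) (F : I -> V) (y : W) :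
  (\sum_(i <- r) F i) \ot y = \sum_(i <- r) F i \ot y.
Proof. exact: (raddf_sum (linmap ((pure_bilinear V W).1 y))). Qed.
Lemma pure_sumr I (r : seq I) (x : V) (F : I -> W) :
  x \ot (\sum_(i <- r) F i) = \sum_(i <- r) x \ot F i.
Proof. exact: (raddf_sum (linmap ((pure_bilinear V W).2 x))). Qed.

Lemma pure0r (x : V) : x \ot (0 : W) = 0.
Proof. exact: (raddf0 (linmap ((pure_bilinear V W).2 x))). Qed.
Lemma pure0l (y : W) : (0 : V) \ot y = 0.
Proof. exact: (raddf0 (linmap ((pure_bilinear V W).1 y))). Qed.

Lemma tensor_ind (P : (V \ox W)%type -> Prop) :
  P 0 -> (forall u v, P u -> P v -> P (u + v)) -> (forall x y, P (x \ot y)) ->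
  forall u, P u.
Proof.
by move=> P0 PD Pp u; rewrite [u]tensorE; elim/big_ind: _ => // p _; apply: Pp.
Qed.

Lemma tensor_sumE (u : (V \ox W)%type) :
  exists n (x : 'I_n -> V) (y : 'I_n -> W), u = \sum_i x i \ot y i.
Proof.
exists (size (repr u)), (fun i => (nth (0, 0) (repr u) i).1),
  (fun i => (nth (0, 0) (repr u) i).2).
by rewrite {1}[u]tensorE (big_nth (0, 0)) big_mkord.
Qed.

End PureTensors.

Section LmodQuotient.
Local Open Scope quotient_scope.
Variables (R : comNzRingType) (V : lmodType R) (W : V -> Prop).
Hypotheses (W0 : W 0) (WP : forall a u v, W u -> W v -> W (a *: u + v)).

Definition lquot_eqv : rel V := fun u v => `[< W (u - v) >].

Lemma lquot_eqv_equiv : equiv_class_of lquot_eqv.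
Proof.
have WN u : W u -> W (- u).
  by move=> Wu; rewrite -scaleN1r -[_ *: u]addr0; apply: WP.
split=> [u|u v|v u w].
- by apply/asboolP; rewrite subrr.
- by apply/asboolP/asboolP => /WN; rewrite opprB.
- move=> /asboolP uv /asboolP vw; apply/asboolP.
  by rewrite -(subrK v u) -addrA -[u - v]scale1r; apply: WP.
Qed.

Canonical lquot_equiv := EquivRelPack lquot_eqv_equiv.
Definition lquot := {eq_quot lquot_equiv}.
HB.instance Definition _ := EqQuotient.on lquot.
HB.instance Definition _ := Choice.on lquot.

Lemma lquotP u v : \pi_lquot u = \pi_lquot v <-> W (u - v).
Proof. by split=> [/eqquotP /asboolP|h] //; apply/eqquotP/asboolP. Qed.

(** The operations are locked: unification would otherwise unfold them while
    matching the class of a vector. *)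
Definition lqadd (x y : lquot) : lquot := locked (\pi_lquot (repr x + repr y)).
Definition lqscale (a : R) (x : lquot) : lquot :=
  locked (\pi_lquot (a *: repr x)).

Lemma lqaddE u v : lqadd (\pi_lquot u) (\pi_lquot v) = \pi_lquot (u + v).
Proof.
have h w : W (repr (\pi_lquot w) - w) by apply/lquotP; rewrite reprK.
rewrite /lqadd -lock; apply/lquotP; rewrite opprD addrACA -[X in X + _]scale1r.
exact: WP.
Qed.

Lemma lqscaleE a u : lqscale a (\pi_lquot u) = \pi_lquot (a *: u).
Proof.
have h w : W (repr (\pi_lquot w) - w) by apply/lquotP; rewrite reprK.
rewrite /lqscale -lock; apply/lquotP; rewrite -scalerBr -[_ *: _]addr0.
exact: WP.
Qed.

Lemma lqaddA : associative lqadd.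
Proof.
by elim/quotW=> x; elim/quotW=> y; elim/quotW=> z; rewrite !lqaddE addrA.
Qed.
Lemma lqaddC : commutative lqadd.
Proof. by elim/quotW=> x; elim/quotW=> y; rewrite !lqaddE addrC. Qed.
Lemma lqadd0 : left_id (\pi_lquot 0) lqadd.
Proof. by elim/quotW=> x; rewrite !lqaddE add0r. Qed.
Lemma lqaddN : left_inverse (\pi_lquot 0) (lqscale (-1)) lqadd.
Proof.
by elim/quotW=> x; rewrite !(lqscaleE, lqaddE) scaleN1r addNr.
Qed.
HB.instance Definition _ :=
  GRing.isZmodule.Build lquot lqaddA lqaddC lqadd0 lqaddN.

Lemma lqscaleA a b x : lqscale a (lqscale b x) = lqscale (a * b) x.
Proof. by elim/quotW: x => x; rewrite !lqscaleE scalerA. Qed.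
Lemma lqscale1 : left_id 1 lqscale.
Proof. by elim/quotW=> x; rewrite !lqscaleE scale1r. Qed.
Lemma lqscaleDr : right_distributive lqscale lqadd.
Proof.
move=> a; elim/quotW=> x; elim/quotW=> y.
by rewrite !(lqaddE, lqscaleE) scalerDr.
Qed.
Lemma lqscaleDl x : {morph lqscale^~ x : a b / a + b >-> lqadd a b}.
Proof.
by move=> a b; elim/quotW: x => x; rewrite !(lqaddE, lqscaleE) scalerDl.
Qed.
HB.instance Definition _ :=
  GRing.Zmodule_isLmodule.Build R lquot lqscaleA lqscale1 lqscaleDr lqscaleDl.

Lemma lmod_quotient :
  exists (Q : lmodType R) (p : V -> Q),
    is_linear p /\ forall v, p v = 0 <-> W v.
Proof.
exists lquot, (fun v => \pi_lquot v); split=> [a u v|v].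
  by rewrite -lqaddE -lqscaleE.
by split=> [/lquotP|Wv]; [rewrite subr0 | apply/lquotP; rewrite subr0].
Qed.

End LmodQuotient.

Definition submodule (R : pzRingType) (M : lmodType R) (N : M -> Prop) :=
  N 0 /\ forall a u v, N u -> N v -> N (a *: u + v).

Definition linear_on (R : pzRingType) (M : lmodType R) (N : M -> Prop)
    (phi : M -> R) :=
  forall a u v, N u -> N v -> phi (a *: u + v) = a * phi u + phi v.

Section Flatness.
Variables (R : comNzRingType) (M : lmodType R).
Implicit Types (N : M -> Prop) (l : seq M).

Definition functional_on N (phi : M -> R) := submodule N /\ linear_on N phi.

(** Elements of [M \ox X] can only be compared through bilinear maps. The
    one used here sends [(m, x)] to the function [(N, phi) |-> phi m *: x],
    taken modulo the functions that vanish for all large submodules [N]: it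
    is additive in [m] because, given [u] and [v], it is so at every [N]
    that contains both. *)
Lemma pure_sum_eq0 (X : lmodType R) (s : seq (M * X)) :
  \sum_(p <- s) p.1 \ot p.2 = 0 ->
  exists l, forall N phi, functional_on N phi -> {in l, forall m, N m} ->
    \sum_(p <- s) phi p.1 *: p.2 = 0.
Proof.
move=> s0.
pose V : lmodType R := ((M -> Prop) * (M -> R) -> X).
pose W (F : V) := exists l, forall N phi,
  functional_on N phi -> {in l, forall m, N m} -> F (N, phi) = 0.
have W0 : W 0 by exists [::].
have WP a F G : W F -> W G -> W (a *: F + G).
  move=> [l hF] [l' hG]; exists (l ++ l') => N phi hN hl.
  have -> : (a *: F + G) (N, phi) = a *: F (N, phi) + G (N, phi) by [].
  rewrite hF ?hG ?scaler0 ?addr0 // => m ml; apply: hl;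
  by rewrite mem_cat ml ?orbT.
have [Q [p [pl p0]]] := lmod_quotient W0 WP.
pose F (m : M) (x : X) : V := fun i => i.2 m *: x.
have bF : is_bilinear (fun m x => p (F m x)).
  split=> [x a u v|m a x y].
    have pB f g : p f = p g <-> p (f - g) = 0.
      rewrite -[f - g]addrC -scaleN1r pl scaleN1r; split=> [->|].
        by rewrite addNr.
      by move/eqP; rewrite addrC subr_eq0 => /eqP.
    rewrite -pl; apply/pB/p0; exists [:: u; v] => N phi [_ lp] hN.
    have Nu : N u by apply: hN; rewrite !inE eqxx.
    have Nv : N v by apply: hN; rewrite !inE eqxx orbT.
    have -> : (F (a *: u + v) x - (a *: F u x + F v x)) (N, phi) =
       phi (a *: u + v) *: x - (a *: (phi u *: x) + phi v *: x) by [].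
    by rewrite lp // scalerA -scalerDl subrr.
  rewrite -pl; congr p; apply/funext => i.
  have -> : (a *: F m x + F m y) i = a *: (i.2 m *: x) + i.2 m *: y by [].
  by rewrite /F scalerDr !scalerA mulrC.
have := congr1 (tlift (fun m x => p (F m x))) s0.
rewrite -[tlift _]/(linmap (tlift_linear bF) : _ -> _) raddf_sum raddf0.
under eq_bigr => q _ do rewrite /= tlift_pure //.
rewrite -[p]/(linmap pl : _ -> _) -raddf_sum => /p0 [l hl].
by exists l => N phi hN /(hl _ _ hN); rewrite functions.fct_sumE.
Qed.

(** Finite subsets lie in finitely generated projective submodules,
    described by dual bases, of which [e] spans a free direct summand. *)
Definition locally_split (e : M) := forall l, exists N,
  [/\ N e, {in l, forall m, N m},
      exists n (c : 'I_n -> M) (phi : 'I_n -> M -> R),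
        [/\ forall i, N (c i), forall i, functional_on N (phi i)
          & forall m, N m -> m = \sum_i phi i m *: c i]
    & exists2 psi, functional_on N psi & psi e = 1].

(** A dual basis of [N] expands a tensor with coefficients in [N] along the
    [c i], and by [pure_sum_eq0] a tensor that vanishes has vanishing
    coordinates as soon as [N] is large; so exactness can be tested on
    coordinates. Conversely [psi] recovers [y] from [e \ot y]. *)
Lemma locally_split_faithfully_flat e : locally_split e -> faithfully_flat M.
Proof.
have bil (Y Z : lmodType R) (g : {linear Y -> Z}) :
    is_bilinear (fun (m : M) y => m \ot g y).
  by split=> [y a u v|m a u v];
     rewrite ?linearP (pureDl, pureDr) (pureZl, pureZr).
pose tm (Y Z : lmodType R) (g : {linear Y -> Z}) :=
  linmap (tlift_linear (bil _ _ g)).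
have tmE (Y Z : lmodType R) (g : {linear Y -> Z}) :
  tmap (@id M) g = tm _ _ g by [].
have tmp (Y Z : lmodType R) (g : {linear Y -> Z}) m y :
  tm _ _ g (m \ot y) = m \ot g y by rewrite /= tlift_pure.
have tmS (Y Z : lmodType R) (g : {linear Y -> Z}) I (r : seq I) F :
    tm _ _ g (\sum_(i <- r) F i) = \sum_(i <- r) tm _ _ g (F i).
  exact: (raddf_sum (tm _ _ g)).
have tsum (Y Z : lmodType R) (g : {linear Y -> Z}) (u : (M \ox Y)%type) :
    tm _ _ g u = \sum_(q <- [seq (p.1, g p.2) | p <- repr u]) q.1 \ot q.2.
  rewrite big_map {1}[u]tensorE tmS.
  by apply: eq_bigr => q _; rewrite tmp.
move=> loc X Y Z f g; split=> ex.
  move=> v; rewrite !tmE; split=> [|[u <-]]; last first.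
    rewrite [u]tensorE !tmS big1 // => q _; rewrite !tmp.
    have -> : g (f q.2) = 0 by apply/ex; exists q.2.
    exact: pure0r.
  rewrite tsum => /pure_sum_eq0 [l hl].
  have [N [_ hN [n [c [phi [Nc lphi dec]]]] _]] := loc (l ++ map fst (repr v)).
  have Nl : {in l, forall m, N m} by move=> m ml; apply: hN; rewrite mem_cat ml.
  have Ns : {in repr v, forall q, N q.1}.
    by move=> q qv; apply: hN; rewrite mem_cat map_f ?orbT.
  have xP i : exists x, f x = \sum_(q <- repr v) phi i q.1 *: q.2.
    apply/ex; have := hl _ _ (lphi i) Nl; rewrite big_map => <-.
    by rewrite linear_sum; apply: eq_bigr => q _; rewrite linearZ_LR.
  have [x fx] := choice xP.
  exists (\sum_i c i \ot x i); rewrite tmS [v]tensorE.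
  under eq_bigr => i _ do rewrite tmp fx pure_sumr.
  rewrite exchange_big /=; apply: eq_big_seq => q /Ns /dec dq.
  by rewrite [in RHS]dq pure_suml; apply: eq_bigr => i _; rewrite pureZl pureZr.
have gf x : g (f x) = 0.
  have : tm _ _ g (tm _ _ f (e \ot x)) = 0.
    by apply/ex; exists (e \ot x).
  rewrite !tmp => e0.
  have /pure_sum_eq0 [l hl] : \sum_(q <- [:: (e, g (f x))]) q.1 \ot q.2 = 0.
    by rewrite big_seq1.
  have [N [_ hN _ [psi lpsi psi1]]] := loc l.
  by have := hl _ _ lpsi hN; rewrite big_seq1 /= psi1 scale1r.
move=> y; split=> [gy|[x <-] //].
have : tm _ _ g (e \ot y) = 0.
  by rewrite tmp gy pure0r.
move/ex => [u]; rewrite [tmap _ _ _]tsum => euy.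
have /pure_sum_eq0 [l hl] : \sum_(q <- (e, y) ::
    [seq (p.1, - f p.2) | p <- repr u]) q.1 \ot q.2 = 0.
  rewrite big_cons -[X in X + _]euy /= !big_map -big_split big1 //= => q _.
  by rewrite -pureDr addrN pure0r.
have [N [Ne hN _ [psi lpsi psi1]]] := loc l.
exists (\sum_(q <- repr u) psi q.1 *: q.2).
have := hl _ _ lpsi hN; rewrite big_cons /= psi1 scale1r big_map /= => /eqP.
rewrite addr_eq0 => /eqP ->; rewrite linear_sum -sumrN.
by apply: eq_bigr => q _; rewrite linearZ_LR scalerN opprK.
Qed.

End Flatness.

(** * Finite-dimensionality in coalgebras *)

Section DualFamily.
Variables (k : fieldType) (V : lmodType k) (I : finType) (v : I -> V).

Definition dual_on (P : {set I}) (lam : I -> V -> k^o) :=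
  (forall i, is_linear (lam i)) /\
  {in P &, forall i j, lam i (v j) = (i == j)%:R}.

(** A maximal subfamily that admits dual functionals spans the family:
    otherwise a form that does not vanish on the defect of some [v i] would
    enlarge it. *)
Lemma dual_family :
  exists m (idx : 'I_m -> I) (lam : 'I_m -> {linear V -> k^o}),
  (forall i j, lam i (v (idx j)) = (i == j)%:R) /\
  forall i, v i = \sum_j lam j (v i) *: v (idx j).
Proof.
have lin0 : is_linear ((fun=> 0) : V -> k^o) by move=> *; rewrite scaler0 addr0.
pose dual P := `[< exists lam, dual_on P lam >].
have dual0 : dual set0.
  by apply/asboolP; exists (fun _ _ => 0); split=> // i j; rewrite inE.
case: (@arg_maxnP _ _ dual (fun P => #|P|) dual0) => P.
move=> /asboolP [lam [ll dl]] Pmax.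
pose lm i := linmap (ll i).
have span i : v i = \sum_(j in P) lam j (v i) *: v j.
  apply/eqP; rewrite -subr_eq0; apply/negPn/negP => w0.
  have [phi lphi phiw] := separating_form w0.
  pose psi u := phi (u - \sum_(j in P) lam j u *: v j).
  have lpsi : is_linear psi.
    move=> a u u'; rewrite /psi -lphi; congr phi.
    rewrite scalerBr addrACA -opprD scaler_sumr -big_split /=.
    congr (_ - _); apply: eq_bigr => j _.
    by rewrite ll scalerDl scalerA.
  have psiP j : j \in P -> psi (v j) = 0.
    move=> jP; rewrite /psi (bigD1 j) //= dl // eqxx scale1r.
    rewrite big1 => [|l /andP[lP lj]].
      by rewrite addr0 subrr -[phi]/(linmap lphi : _ -> _) linear0.
    by rewrite dl // (negPf lj) scale0r.
  have iP : i \notin P.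
    by apply/negP => /psiP; rewrite /psi phiw => /eqP; rewrite oner_eq0.
  have /Pmax : dual (i |: P).
    apply/asboolP; exists (fun j => if j == i then psi else
      fun u => lam j u - lam j (v i) *: psi u); split=> [j|j l].
      case: eqP => // _ a u u'; rewrite ll lpsi !scalerDr scalerN !scalerA.
      by rewrite [_ * a]mulrC opprD addrACA.
    rewrite !inE => /predU1P[->|jP]; [rewrite eqxx|] => /predU1P[->|lP].
    - by rewrite eqxx /psi phiw.
    - by rewrite psiP //; case: eqP iP lP => // -> /negPf->.
    - rewrite (negPf (memPn iP j jP)).
      by rewrite /= /psi phiw [_ *: 1]mulr1 subrr.
    - rewrite (negPf (memPn iP j jP)).
      by rewrite psiP // scaler0 subr0 dl.
  by rewrite /= cardsU1 iP add1n => /(leq_trans (ltnSn _)); rewrite ltnn.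
exists #|P|, enum_val, (fun j => lm (enum_val j)); split=> [i j|i].
  by rewrite /= dl ?enum_valP // (inj_eq enum_val_inj).
by rewrite [LHS]span big_enum_val.
Qed.

End DualFamily.

Section Rank.
Variables (k : fieldType) (V W : lmodType k).

(** The functionals record that both families are linearly independent. The
    right family is reduced to a basis first and the left one second; the
    right family obtained at the end is still dual to functionals found at
    the first step. *)
Lemma rank_decomposition (u : (V \ox W)%type) :
  exists n (x : 'I_n -> V) (y : 'I_n -> W)
      (mu : 'I_n -> {linear V -> k^o}) (lam : 'I_n -> {linear W -> k^o}),
  [/\ u = \sum_i x i \ot y i, forall i j, mu i (x j) = (i == j)%:R
    & forall i j, lam i (y j) = (i == j)%:R].
Proof.
have [n0 [x0 [y0 ->]]] := tensor_sumE u.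
have [n1 [id1 [lam [dlam y0E]]]] := dual_family y0.
pose x1 j := \sum_i lam j (y0 i) *: x0 i.
have [n [id2 [mu [dmu x1E]]]] := dual_family x1.
exists n, (fun q => x1 (id2 q)),
  (fun q => \sum_p mu q (x1 p) *: y0 (id1 p)), mu, (fun q => lam (id2 q)).
split=> // [|i j].
  transitivity (\sum_p x1 p \ot y0 (id1 p)).
    under eq_bigr => i _ do rewrite {1}y0E pure_sumr.
    rewrite exchange_big; apply: eq_bigr => p _.
    rewrite pure_suml; apply: eq_bigr => i _.
    by rewrite pureZr pureZl.
  under eq_bigr => i _ do rewrite {1}x1E pure_suml.
  rewrite exchange_big; apply: eq_bigr => q _.
  rewrite pure_sumr; apply: eq_bigr => p _.
  by rewrite pureZr pureZl.
rewrite linear_sum (bigD1 (id2 i)) //= linearZ_LR /= dlam eqxx big1 => [|p pi].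
  by rewrite addr0 dmu [_ *: 1]mulr1 eq_sym.
by rewrite linearZ_LR /= dlam eq_sym (negPf pi) scaler0.
Qed.

Lemma tlift_id_bilinear (lam : {linear W -> k^o}) :
  is_bilinear (fun (x : V) (y : W) => (lam y : k) *: x).
Proof.
split=> [y a x x'|x a y y'].
  by rewrite scalerDr !scalerA mulrC.
by rewrite linearP scalerDl scalerA.
Qed.

End Rank.

Section Maps.
Variable k : fieldType.

Lemma tmap_bilinear (M N M' N' : lmodType k) (f : {linear M -> M'})
  (g : {linear N -> N'}) : is_bilinear (fun x y => f x \ot g y).
Proof.
by split=> [y a u v|x a u v];
   rewrite linearP ?(pureDl, pureDr) ?(pureZl, pureZr).
Qed.

Definition tmapL (M N M' N' : lmodType k) (f : {linear M -> M'})
    (g : {linear N -> N'}) : {linear (M \ox N)%type -> (M' \ox N')%type} :=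
  linmap (tlift_linear (tmap_bilinear f g)).

Lemma tmapL_pure (M N M' N' : lmodType k) (f : {linear M -> M'})
  (g : {linear N -> N'}) x y : tmapL f g (x \ot y) = f x \ot g y.
Proof. exact: (tlift_pure _ _ (tmap_bilinear f g)). Qed.

Definition purel (M N : lmodType k) (y : N) : {linear M -> (M \ox N)%type} :=
  linmap ((pure_bilinear M N).1 y).

Section Assoc.
Variable C : lmodType k.

Lemma tassoc_bilinear1 (z : C) : is_bilinear (fun x y : C => x \ot (y \ot z)).
Proof.
by split=> [y a u v|x a u v]; rewrite ?(pureDl, pureDr) ?(pureZl, pureZr).
Qed.

Lemma tassoc_bilinear : is_bilinear (fun (u : (C \ox C)%type) (z : C) =>
  tlift (fun x y => x \ot (y \ot z)) u).
Proof.
pose tz z := linmap (tlift_linear (tassoc_bilinear1 z)).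
split=> [z a u v|u a z z']; first exact/tlift_linear/tassoc_bilinear1.
have e : tz (a *: z + z') =1 (a \*: tz z) \+ tz z'.
  apply: tensor_ext => x y; rewrite /= !tlift_pure ?pureDr ?pureZr //;
  exact: tassoc_bilinear1.
exact: e.
Qed.

Definition tassocL :
    {linear ((C \ox C) \ox C)%type -> (C \ox (C \ox C))%type} :=
  linmap (tlift_linear tassoc_bilinear).

Lemma tassocL_pure (x y z : C) : tassocL ((x \ot y) \ot z) = x \ot (y \ot z).
Proof.
rewrite /= tlift_pure; last exact: tassoc_bilinear.
by rewrite tlift_pure //; apply: tassoc_bilinear1.
Qed.

End Assoc.

Definition rslice (W V : lmodType k) (lam : {linear W -> k^o}) :
    {linear (V \ox W)%type -> V} :=
  linmap (tlift_linear (tlift_id_bilinear V lam)).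

Lemma rslice_pure (W V : lmodType k) (lam : {linear W -> k^o}) x y :
  rslice V lam (x \ot y) = (lam y : k) *: x.
Proof. by rewrite /= tlift_pure //; apply: tlift_id_bilinear. Qed.

Lemma lslice_bilinear (V W : lmodType k) (mu : {linear V -> k^o}) :
  is_bilinear (fun (x : V) (y : W) => (mu x : k) *: y).
Proof.
split=> [y a x x'|x a y y']; first by rewrite linearP scalerDl scalerA.
by rewrite scalerDr !scalerA mulrC.
Qed.

Definition lslice (V W : lmodType k) (mu : {linear V -> k^o}) :
    {linear (V \ox W)%type -> W} :=
  linmap (tlift_linear (lslice_bilinear W mu)).

Lemma lslice_pure (V W : lmodType k) (mu : {linear V -> k^o}) x y :
  lslice W mu (x \ot y) = (mu x : k) *: y.
Proof. by rewrite /= tlift_pure //; apply: lslice_bilinear. Qed.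

End Maps.

Arguments rslice {k W} V lam : simpl never.
Arguments lslice {k V} W mu : simpl never.
Arguments tmapL : simpl never.
Arguments tassocL : simpl never.

Lemma sum_delta (k : fieldType) (V : lmodType k) n (F : 'I_n -> V) j :
  \sum_i ((j == i)%:R : k) *: F i = F j.
Proof.
rewrite (bigD1 j) //= eqxx scale1r big1 ?addr0 // => i ij.
by rewrite eq_sym (negPf ij) scale0r.
Qed.

Section Fundamental.
Variables (k : fieldType) (C : coalgType k).

(** The multiplicative matrices, that is, the coefficient matrices of
    finite-dimensional comodules. *)
Definition matrix_coalg n (m : 'I_n -> 'I_n -> C) :=
  (forall i j, comul (m i j) = \sum_l m i l \ot m l j) /\
  forall i j, counit (m i j) = (i == j)%:R.

Lemma comulAL (x : C) :
  tassocL C (tmapL comul idfun (comul x)) = tmapL idfun comul (comul x).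
Proof. exact: comulA. Qed.

(** Coassociativity, with the last factor contracted by [lam]. *)
Lemma comul_rslice (lam : {linear C -> k^o}) (x : C) :
  comul (rslice C lam (comul x)) =
  tmapL idfun (rslice C lam \o comul) (comul x).
Proof.
have step : comul \o rslice C lam =1
    tmapL idfun (rslice C lam) \o tassocL C \o tmapL comul idfun.
  apply: tensor_ext => y z.
  change (comul (rslice C lam (y \ot z)) = tmapL idfun (rslice C lam)
    (tassocL C (tmapL comul idfun (y \ot z)))).
  rewrite rslice_pure tmapL_pure linearZ_LR.
  have ez : (lam z : k) \*: @idfun (C \ox C)%type =1
      tmapL idfun (rslice C lam) \o tassocL C \o purel (C \ox C)%type z.
    apply: tensor_ext => a b.
    change ((lam z : k) *: (a \ot b) =
      tmapL idfun (rslice C lam) (tassocL C (a \ot b \ot z))).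
    rewrite tassocL_pure tmapL_pure rslice_pure.
    by rewrite pureZr.
  exact: ez.
rewrite [LHS]step /comp comulAL.
pose L : {linear (C \ox C)%type -> (C \ox C)%type} :=
  tmapL idfun (rslice C lam) \o tmapL (M' := C) idfun comul.
have e : L =1 tmapL idfun (rslice C lam \o comul).
  apply: tensor_ext => y z; change (tmapL idfun (rslice C lam)
    (tmapL idfun comul (y \ot z)) =
    tmapL idfun (rslice C lam \o comul) (y \ot z)).
  by rewrite !tmapL_pure.
exact: e.
Qed.

(** In a decomposition [comul x = \sum_i h i \ot y i] with independent
    families the [h i] span the subcomodule generated by [x]. Its
    coefficients are [m i j = (id (x) lam j) (comul (y i))], and since the
    [h i] are independent, coassociativity determines first [comul (y i)]
    and then [comul (m i j)]. *)
Theorem coalgebra_finiteness (x : C) :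
  exists n (h : 'I_n -> C) (m : 'I_n -> 'I_n -> C) (a : 'I_n -> k),
  [/\ x = \sum_i a i *: h i, forall j, comul (h j) = \sum_i h i \ot m i j
    & matrix_coalg m].
Proof.
have [n [h [y [mu [lam [xE dmu dlam]]]]]] := rank_decomposition (comul x).
pose m i j := rslice C (lam j) (comul (y i)).
have hE j : h j = rslice C (lam j) (comul x).
  rewrite xE linear_sum.
  by under eq_bigr => i _ do rewrite rslice_pure dlam; rewrite sum_delta.
have comulh j : comul (h j) = \sum_i h i \ot m i j.
  rewrite hE comul_rslice xE linear_sum; apply: eq_bigr => i _.
  exact: tmapL_pure.
have lsl i (u : 'I_n -> (C \ox C)%type) :
    lslice (C \ox C)%type (mu i) (\sum_j h j \ot u j) = u i.
  rewrite linear_sum.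
  by under eq_bigr => j _ do rewrite lslice_pure dmu; rewrite sum_delta.
have comuly i : comul (y i) = \sum_j m i j \ot y j.
  have := comulAL x; rewrite xE.
  rewrite (linear_sum (tmapL comul idfun)) (linear_sum (tmapL idfun comul)).
  under eq_bigr => j _.
    rewrite tmapL_pure comulh pure_suml; over.
  rewrite linear_sum.
  under eq_bigr => j _.
    rewrite linear_sum; under eq_bigr => l _ do rewrite tassocL_pure.
    over.
  under [RHS]eq_bigr => j _ do rewrite tmapL_pure.
  rewrite exchange_big; under eq_bigr => l _ do rewrite -pure_sumr.
  by move=> /(congr1 (lslice _ (mu i))); rewrite !lsl.
exists n, h, m, (fun i => counit (y i)); split=> //.
  have cx : rslice C counit (comul x) = x := counitr x.
  rewrite -[LHS]cx xE linear_sum.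
  by apply: eq_bigr => i _; rewrite rslice_pure.
split=> i j.
  rewrite comul_rslice comuly linear_sum.
  by apply: eq_bigr => l _; rewrite tmapL_pure.
transitivity (lam j (lslice C counit (comul (y i)))); last first.
  have -> : lslice C counit (comul (y i)) = y i := counitl (y i).
  by rewrite dlam eq_sym.
have e : counit \o rslice C (lam j) =1 lam j \o lslice C counit.
  apply: tensor_ext => a b.
  change (counit (rslice C (lam j) (a \ot b)) =
    lam j (lslice C counit (a \ot b))).
  by rewrite rslice_pure lslice_pure !linearZ_LR /= [LHS]mulrC.
exact: e.
Qed.

End Fundamental.

(** * The tensor square of a commutative algebra *)

Section TensorMultiplication.
Variables (k : fieldType) (A : algType k).

Lemma tmul_bilinear1 (a b : A) :
  is_bilinear (fun c d : A => (a * c) \ot (b * d)).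
Proof.
by split=> [y z u v|x z u v];
   rewrite mulrDr -scalerAr ?(pureDl, pureDr) ?(pureZl, pureZr).
Qed.

Lemma tmul_bilinear2 (v : (A \ox A)%type) :
  is_bilinear (fun a b : A => tlift (fun c d => (a * c) \ot (b * d)) v).
Proof.
pose L a b := linmap (tlift_linear (tmul_bilinear1 a b)).
split=> [b z a a'|a z b b'].
  have e : L (z *: a + a') b =1 (z \*: L a b) \+ L a' b.
    apply: tensor_ext => c d; rewrite /= !tlift_pure; try exact: tmul_bilinear1.
    by rewrite mulrDl -scalerAl pureDl pureZl.
  exact: e.
have e : L a (z *: b + b') =1 (z \*: L a b) \+ L a b'.
  apply: tensor_ext => c d; rewrite /= !tlift_pure; try exact: tmul_bilinear1.
  by rewrite mulrDl -scalerAl pureDr pureZr.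
exact: e.
Qed.

Lemma tmul_pure (a b c d : A) :
  tmul (a \ot b) (c \ot d) = (a * c) \ot (b * d).
Proof.
rewrite /tmul tlift_pure; last exact: tmul_bilinear2.
by rewrite tlift_pure //; apply: tmul_bilinear1.
Qed.

Lemma tmul_sum (I J : finType) (x y : I -> A) (z w : J -> A) :
  tmul (\sum_i x i \ot y i) (\sum_j z j \ot w j) =
  \sum_(p : I * J) (x p.1 * z p.2) \ot (y p.1 * w p.2).
Proof.
rewrite -[LHS]/(linmap (tlift_linear (tmul_bilinear2 _)) _) linear_sum.
rewrite -(pair_bigA _ (fun i j => (x i * z j) \ot (y i * w j))) /=.
apply: eq_bigr => i _; rewrite /= tlift_pure; last exact: tmul_bilinear2.
rewrite -[LHS]/(linmap (tlift_linear (tmul_bilinear1 _ _)) _) linear_sum.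
by apply: eq_bigr => j _; rewrite /= tlift_pure //; apply: tmul_bilinear1.
Qed.

End TensorMultiplication.

Section TensorAlgebra.
Variables (k : fieldType) (A : comAlgType k).

(** A separate name for the tensor square, to carry its ring structure. *)
Definition talg := (A \ox A)%type.
HB.instance Definition _ := GRing.Lmodule.on talg.

Definition talg_mul (u v : talg) : talg := tmul u v.

Lemma talg_mul_pure (a b c d : A) :
  talg_mul (a \ot b) (c \ot d) = (a * c) \ot (b * d).
Proof. exact: tmul_pure. Qed.

Lemma talg_mulDl : left_distributive talg_mul +%R.
Proof.
move=> u v w.
exact: (raddfD (linmap (tlift_linear (tmul_bilinear2 w)))).
Qed.

Lemma talg_mul0 (u : talg) : talg_mul 0 u = 0.
Proof. exact: (raddf0 (linmap (tlift_linear (tmul_bilinear2 u)))). Qed.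

Lemma talg_mulZl (a : k) (u v : talg) : a *: talg_mul u v = talg_mul (a *: u) v.
Proof.
exact/esym/(linearZ_LR (linmap (tlift_linear (tmul_bilinear2 v)))).
Qed.

Lemma talg_mul_pureD (a b : A) (v w : talg) :
  talg_mul (a \ot b) (v + w) = talg_mul (a \ot b) v + talg_mul (a \ot b) w.
Proof.
rewrite /talg_mul /tmul !tlift_pure; try exact: tmul_bilinear2.
exact: (raddfD (linmap (tlift_linear (tmul_bilinear1 a b)))).
Qed.

Lemma talg_mul_pure0 (a b : A) : talg_mul (a \ot b) 0 = 0.
Proof.
rewrite /talg_mul /tmul !tlift_pure; try exact: tmul_bilinear2.
exact: (raddf0 (linmap (tlift_linear (tmul_bilinear1 a b)))).
Qed.

Lemma talg_mulC : commutative talg_mul.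
Proof.
elim/tensor_ind=> [|u v IHu IHv|a b] w.
- rewrite talg_mul0; elim/tensor_ind: w => [|u v IHu IHv|a b].
  + by rewrite talg_mul0.
  + by rewrite talg_mulDl -IHu -IHv addr0.
  + by rewrite talg_mul_pure0.
- rewrite talg_mulDl IHu IHv.
  elim/tensor_ind: w {IHu IHv} => [|w x IHw IHx|a b].
  + by rewrite !talg_mul0 addr0.
  + by rewrite !talg_mulDl -IHw -IHx addrACA.
  + by rewrite talg_mul_pureD.
- elim/tensor_ind: w => [|w x IHw IHx|c d].
  + by rewrite talg_mul0 talg_mul_pure0.
  + by rewrite talg_mulDl talg_mul_pureD IHw IHx.
  + by rewrite !talg_mul_pure mulrC [b * d]mulrC.
Qed.

Lemma talg_mulA : associative talg_mul.
Proof.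
have mulDr u v w : talg_mul u (v + w) = talg_mul u v + talg_mul u w.
  by rewrite !(talg_mulC u) talg_mulDl.
have mul0 u : talg_mul u 0 = 0 by rewrite talg_mulC talg_mul0.
elim/tensor_ind=> [|u u' IHu IHu'|a a'] v w.
- by rewrite !talg_mul0.
- by rewrite !talg_mulDl IHu IHu'.
elim/tensor_ind: v => [|v v' IHv IHv'|b b'].
- by rewrite !(mul0, talg_mul0).
- by rewrite !(mulDr, talg_mulDl) IHv IHv'.
elim/tensor_ind: w => [|w w' IHw IHw'|c c'].
- by rewrite !(mul0, talg_mul0).
- by rewrite !(mulDr, talg_mulDl) IHw IHw'.
- by rewrite !talg_mul_pure !mulrA.
Qed.

Lemma talg_mul1 : left_id (1 \ot 1) talg_mul.
Proof.
elim/tensor_ind=> [|u v IHu IHv|a b].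
- by rewrite talg_mul_pure0.
- by rewrite talg_mul_pureD IHu IHv.
- by rewrite talg_mul_pure !mul1r.
Qed.

Lemma talg_one_neq0 : (1 \ot 1 : talg) != 0.
Proof.
have [phi lphi phi1] := separating_form (oner_neq0 A).
apply/eqP => /(congr1 (rslice A (linmap lphi))).
rewrite rslice_pure raddf0 /= phi1 scale1r => /eqP.
by rewrite oner_eq0.
Qed.

HB.instance Definition _ := GRing.Zmodule_isComNzRing.Build talg
  talg_mulA talg_mulC talg_mul1 talg_mulDl talg_one_neq0.
HB.instance Definition _ := GRing.Lmodule_isLalgebra.Build k talg talg_mulZl.
Lemma talg_mulZr (a : k) (u v : talg) : a *: (u * v) = u * (a *: v).
Proof. by rewrite [RHS]mulrC -scalerAl mulrC. Qed.
HB.instance Definition _ := GRing.Lalgebra_isAlgebra.Build k talg talg_mulZr.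

Lemma talgM (a b c d : A) :
  (a \ot b : talg) * (c \ot d : talg) = (a * c) \ot (b * d).
Proof. exact: talg_mul_pure. Qed.

Lemma talg_sumM (I J : finType) (x y : I -> A) (z w : J -> A) :
  (\sum_i x i \ot y i : talg) * (\sum_j z j \ot w j : talg) =
  \sum_(p : I * J) (x p.1 * z p.2) \ot (y p.1 * w p.2).
Proof.
exact: tmul_sum.
Qed.

Definition inl_alg (a : A) : talg := a \ot 1.
Definition inr_alg (a : A) : talg := 1 \ot a.

Lemma inl_alg_linear : is_linear inl_alg.
Proof. exact: (pure_bilinear A A).1. Qed.
Lemma inr_alg_linear : is_linear inr_alg.
Proof. exact: (pure_bilinear A A).2. Qed.
Lemma inl_alg_monoid : monoid_morphism inl_alg.
Proof. by split=> // a b; rewrite /inl_alg talgM mulr1. Qed.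
Lemma inr_alg_monoid : monoid_morphism inr_alg.
Proof. by split=> // a b; rewrite /inr_alg talgM mulr1. Qed.
HB.instance Definition _ := GRing.isLinear.Build k A talg *:%R inl_alg
  inl_alg_linear.
HB.instance Definition _ := GRing.isLinear.Build k A talg *:%R inr_alg
  inr_alg_linear.
HB.instance Definition _ := GRing.isMonoidMorphism.Build A talg inl_alg
  inl_alg_monoid.
HB.instance Definition _ := GRing.isMonoidMorphism.Build A talg inr_alg
  inr_alg_monoid.

Lemma pure_inl_inr (a b : A) : a \ot b = inl_alg a * inr_alg b.
Proof. by rewrite talgM mulr1 mul1r. Qed.

(** The tensor square is the coproduct of two copies of [A] among
    commutative algebras. *)
Section Copair.
Variables (R : comAlgType k) (f g : {lrmorphism A -> R}).

Lemma copair_bilinear : is_bilinear (fun a b : A => f a * g b).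
Proof.
split=> [b z a a'|a z b b']; first by rewrite linearP mulrDl -scalerAl.
by rewrite linearP mulrDr -scalerAr.
Qed.

Definition copair : talg -> R := tlift (fun a b : A => f a * g b).

Lemma copair_pure a b : copair (a \ot b) = f a * g b.
Proof. exact: tlift_pure copair_bilinear. Qed.

Lemma copair_linear : is_linear copair.
Proof. exact: tlift_linear copair_bilinear. Qed.
HB.instance Definition _ := GRing.isLinear.Build k talg R *:%R copair
  copair_linear.

Lemma copair_monoid : monoid_morphism copair.
Proof.
split=> [|u v]; first by rewrite copair_pure !rmorph1 mulr1.
have D u1 u2 : copair (u1 + u2) = copair u1 + copair u2 := raddfD _ u1 u2.
elim/tensor_ind: u => [|u u' IHu IHu'|a a'].
- by rewrite mul0r raddf0 mul0r.
- by rewrite mulrDl !D mulrDl IHu IHu'.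
elim/tensor_ind: v => [|v v' IHv IHv'|b b'].
- by rewrite mulr0 raddf0 mulr0.
- by rewrite mulrDr !D mulrDr IHv IHv'.
by rewrite talgM !copair_pure !rmorphM mulrACA.
Qed.
HB.instance Definition _ := GRing.isMonoidMorphism.Build talg R copair
  copair_monoid.

Lemma copair_inl a : copair (inl_alg a) = f a.
Proof. by rewrite copair_pure rmorph1 mulr1. Qed.
Lemma copair_inr a : copair (inr_alg a) = g a.
Proof. by rewrite copair_pure rmorph1 mul1r. Qed.

End Copair.

Section Theta.
Variable beta : {linear A -> A}.

Lemma rcontract_bilinear : is_bilinear (fun a b : A => a * beta b).
Proof.
split=> [b z a a'|a z b b']; first by rewrite mulrDl -scalerAl.
by rewrite linearP mulrDr -scalerAr.
Qed.

(** Contractions of the second factor are linear over the first one; through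
    them statements over [talg A] descend to [A]. *)
Definition rcontract : talg -> A := tlift (fun a b => a * beta b).
Lemma rcontract_linear : is_linear rcontract.
Proof. exact: tlift_linear rcontract_bilinear. Qed.
HB.instance Definition _ := GRing.isLinear.Build k talg A *:%R rcontract
  rcontract_linear.

Lemma rcontract_pure a b : rcontract (a \ot b) = a * beta b.
Proof. exact: tlift_pure rcontract_bilinear. Qed.

Lemma rcontract_sum I (r : seq I) F :
  rcontract (\sum_(i <- r) F i) = \sum_(i <- r) rcontract (F i).
Proof. exact: (raddf_sum rcontract). Qed.

Lemma rcontractMl a u : rcontract (inl_alg a * u) = a * rcontract u.
Proof.
have D u1 u2 : rcontract (u1 + u2) = rcontract u1 + rcontract u2.
  exact: (raddfD rcontract).
elim/tensor_ind: u => [|u v IHu IHv|b c].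
- by rewrite mulr0 raddf0 mulr0.
- by rewrite mulrDr !D IHu IHv mulrDr.
- by rewrite talgM !rcontract_pure mul1r mulrA.
Qed.

End Theta.

End TensorAlgebra.

(** * Commutative Hopf domains over Hopf subalgebras *)

Section LocalFiniteness.
Variables (k : fieldType) (A : comAlgType k).
Variables rho rhoV : {lrmorphism A -> talg A}.

(** The [c i] span a finite-dimensional subcomodule for [rho] with
    coefficient matrix [M]; the inverse [MV] consists of the antipodes of
    the coefficients when [rhoV] is [a |-> a_1 (x) S a_2]. *)
Definition in_subcomodule (l : seq A) :=
  exists (I : finType) (c : I -> A) (M MV : I -> I -> A),
  [/\ forall i j, \sum_h M i h * MV h j = (i == j)%:R,
      forall j, rho (c j) = \sum_i c i \ot M i j,
      forall j, rhoV (c j) = \sum_i c i \ot MV i j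
    & {in l, forall a, exists v : I -> k, a = \sum_i v i *: c i}].

Lemma in_subcomodule_cat l1 l2 :
  in_subcomodule l1 -> in_subcomodule l2 -> in_subcomodule (l1 ++ l2).
Proof.
move=> [I [c [M [MV [MMV rc rVc sp]]]]] [J [c' [M' [MV' [MMV' rc' rVc' sp']]]]].
pose bl (X : I -> I -> A) (Y : J -> J -> A) (x y : I + J) : A :=
  match x, y with inl i, inl j => X i j | inr i, inr j => Y i j | _, _ => 0 end.
exists (I + J)%type,
  (fun x => match x with inl i => c i | inr j => c' j end),
  (bl M M'), (bl MV MV').
split=> [[i|i] [j|j]|[j|j]|[j|j]|a]; rewrite ?big_sumType /=.
- by rewrite MMV [X in _ + X]big1 ?addr0 // => h _; rewrite mul0r.
- by rewrite !big1 ?addr0 // => h _; rewrite ?mul0r ?mulr0.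
- by rewrite !big1 ?addr0 // => h _; rewrite ?mul0r ?mulr0.
- by rewrite MMV' big1 ?add0r // => h _; rewrite mul0r.
- by rewrite rc [X in _ + X]big1 ?addr0 // => h _; rewrite pure0r.
- by rewrite rc' [X in X + _]big1 ?add0r // => h _; rewrite pure0r.
- by rewrite rVc [X in _ + X]big1 ?addr0 // => h _; rewrite pure0r.
- by rewrite rVc' [X in X + _]big1 ?add0r // => h _; rewrite pure0r.
rewrite mem_cat => /orP[/sp|/sp'] [v ->].
  exists (fun x => match x with inl i => v i | inr _ => 0 end).
  by rewrite big_sumType /= [X in _ + X]big1 ?addr0 // => j _; rewrite scale0r.
exists (fun x => match x with inl _ => 0 | inr j => v j end).
rewrite big_sumType /= [X in _ = X + _]big1 ?add0r // => j _.
by rewrite scale0r.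
Qed.

Lemma in_subcomodule1 : in_subcomodule [:: 1].
Proof.
exists unit, (fun=> 1), (fun _ _ => 1), (fun _ _ => 1); split=> [[] []|_|_|a].
- by rewrite (big_pred1 tt) ?mulr1 // => -[].
- by rewrite (big_pred1 tt) ?rmorph1 // => -[].
- by rewrite (big_pred1 tt) ?rmorph1 // => -[].
rewrite inE => /eqP ->; exists (fun=> 1).
by rewrite (big_pred1 tt) ?scale1r // => -[].
Qed.

Lemma in_subcomoduleP x u v : in_subcomodule [:: u] -> in_subcomodule [:: v] ->
  in_subcomodule [:: x *: u + v].
Proof.
move=> hu /(in_subcomodule_cat hu) [I [c [M [MV [MMV rc rVc sp]]]]].
exists I, c, M, MV; split=> // a; rewrite inE => /eqP ->.
have [|f ->] := sp u; first by rewrite !inE eqxx.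
have [|g ->] := sp v; first by rewrite !inE eqxx orbT.
exists (fun i => x * f i + g i); rewrite scaler_sumr -big_split.
by apply: eq_bigr => i _; rewrite scalerDl scalerA.
Qed.

Lemma in_subcomodule_comb I (r : seq I) (x : I -> k) (u : I -> A) :
  (forall i, in_subcomodule [:: u i]) ->
  in_subcomodule [:: \sum_(i <- r) x i *: u i].
Proof.
move=> hu; elim: r => [|i r IHr]; last first.
  by rewrite big_cons; apply: in_subcomoduleP.
rewrite big_nil -(addNr 1) -scaleN1r.
exact: in_subcomoduleP in_subcomodule1 in_subcomodule1.
Qed.

(** The products of the generators of two subcomodules form a comodule with
    the Kronecker product of the coefficient matrices. *)
Lemma in_subcomoduleM u v : in_subcomodule [:: u] -> in_subcomodule [:: v] ->
  in_subcomodule [:: u * v].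
Proof.
move=> [I [c [M [MV [MMV rc rVc sp]]]]] [J [c' [M' [MV' [MMV' rc' rVc' sp']]]]].
exists (I * J)%type, (fun x => c x.1 * c' x.2),
  (fun x y => M x.1 y.1 * M' x.2 y.2), (fun x y => MV x.1 y.1 * MV' x.2 y.2).
have rhoM x y : rho (x * y) = rho x * rho y := rmorphM rho x y.
have rhoVM x y : rhoV (x * y) = rhoV x * rhoV y := rmorphM rhoV x y.
split=> [[i i'] [j j']|[j j']|[j j']|a] /=.
- under eq_bigr => h _ do rewrite mulrACA.
  rewrite -(pair_bigA _
    (fun h h' => M i h * MV h j * (M' i' h' * MV' h' j'))) /=.
  under eq_bigr => h _ do rewrite -mulr_sumr MMV'.
  by rewrite -mulr_suml MMV -natrM mulnb.
- by rewrite rhoM rc rc' talg_sumM.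
- by rewrite rhoVM rVc rVc' talg_sumM.
rewrite inE => /eqP ->.
have [|f ->] := sp u; first exact: mem_head.
have [|g ->] := sp' v; first exact: mem_head.
exists (fun x => f x.1 * g x.2).
rewrite -(pair_bigA _ (fun h h' => (f h * g h') *: (c h * c' h'))) mulr_suml.
apply: eq_bigr => h _; rewrite mulr_sumr; apply: eq_bigr => h' _ /=.
by rewrite -scalerAl -scalerAr scalerA.
Qed.

Lemma in_subcomodule_seq l :
  (forall a, in_subcomodule [:: a]) -> in_subcomodule l.
Proof.
move=> h; elim: l => [|a l IHl]; last exact: (in_subcomodule_cat (h a)).
by have [I [c [M [MV [? ? ? _]]]]] := h 0; exists I, c, M, MV.
Qed.

(** The trivial subcomodule spanned by [1] is added, as the coordinate [j0]. *)
Lemma in_subcomodule_mx l : in_subcomodule l ->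
  exists n (c : 'rV[A]_n) (M MV : 'M[A]_n) (j0 : 'I_n),
  [/\ M *m MV = 1%:M,
      map_mx rho c = map_mx (@inl_alg k A) c *m map_mx (@inr_alg k A) M,
      map_mx rhoV c = map_mx (@inl_alg k A) c *m map_mx (@inr_alg k A) MV,
      c 0 j0 = 1 /\ forall i, MV i j0 = (i == j0)%:R
    & {in l, forall a, exists v : 'I_n -> k, a = \sum_i v i *: c 0 i}].
Proof.
move=> [I0 [c0 [M0 [MV0 [MMV0 rc0 rVc0 sp0]]]]].
pose I : finType := option I0.
pose c (x : I) := if x is Some i then c0 i else 1.
pose bl (X : I0 -> I0 -> A) (x y : I) : A :=
  match x, y with Some i, Some j => X i j | None, None => 1 | _, _ => 0 end.
have sumI (V : nmodType) (F : I -> V) :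
    \sum_x F x = F None + \sum_i F (Some i).
  rewrite (bigD1 None) //=; congr (_ + _).
  rewrite (reindex_omap Some id) /= => [|[i|] //].
  by apply: eq_bigl => i; rewrite eqxx.
have MMV i j : \sum_h bl M0 i h * bl MV0 h j = (i == j)%:R.
  rewrite sumI; case: i j => [i|] [j|] /=.
  - by rewrite mul0r add0r MMV0.
  - by rewrite mul0r add0r big1 // => h _; rewrite mulr0.
  - by rewrite mulr0 add0r big1 // => h _; rewrite mul0r.
  - by rewrite mul1r big1 ?addr0 // => h _; rewrite mul0r.
have rc (f : {lrmorphism A -> talg A}) X :
    (forall j, f (c0 j) = \sum_i c0 i \ot X i j) ->
    forall j, f (c j) = \sum_i c i \ot bl X i j.
  move=> fX [j|] /=; rewrite sumI /=.
    by rewrite pure0r add0r fX.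
  by rewrite rmorph1 big1 ?addr0 // => h _; rewrite pure0r.
pose e := @enum_val I predT; pose n := #|I|.
have sume (V : nmodType) (F : I -> V) : \sum_x F x = \sum_(i < n) F (e i).
  by rewrite (reindex e) //; apply: onW_bij; apply: enum_val_bij.
exists n, (\row_i c (e i)), (\matrix_(i, j) bl M0 (e i) (e j)),
  (\matrix_(i, j) bl MV0 (e i) (e j)), (enum_rank None).
split; last 1 first.
- move=> a /sp0 [v ->]; exists (fun i => if e i is Some x then v x else 0).
  under [RHS]eq_bigr => i _ do rewrite mxE.
  rewrite -(sume _ (fun x => (if x is Some y then v y else 0) *: c x)) sumI.
  by rewrite scale0r add0r.
- apply/matrixP => i j; rewrite !mxE; under eq_bigr => h _ do rewrite !mxE.
  rewrite -(sume _ (fun h => bl M0 (e i) h * bl MV0 h (e j))) MMV.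
  by rewrite (inj_eq enum_val_inj).
- apply/matrixP => i j; rewrite !mxE (rc _ _ rc0) sume.
  by apply: eq_bigr => h _; rewrite !mxE pure_inl_inr.
- apply/matrixP => i j; rewrite !mxE (rc _ _ rVc0) sume.
  by apply: eq_bigr => h _; rewrite !mxE pure_inl_inr.
split=> [|i]; rewrite !mxE /e enum_rankK //.
rewrite -(inj_eq enum_val_inj) enum_rankK.
by case: (enum_val i) => [x|].
Qed.

End LocalFiniteness.

Section PureSpan.
Variables (k : fieldType) (A : comAlgType k).
Implicit Types P Q : {pred A}.

(** For subspaces [P] and [Q], the image of their tensor product. *)
Definition pure_span P Q (u : talg A) := exists n (x y : 'I_n -> A),
  [/\ forall i, x i \in P, forall i, y i \in Q & u = \sum_i x i \ot y i].

Lemma pure_span_pure P Q x y : x \in P -> y \in Q -> pure_span P Q (x \ot y).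
Proof. by move=> Px Qy; exists 1%N, (fun=> x), (fun=> y); rewrite big_ord1. Qed.

Lemma pure_span0 P Q : pure_span P Q 0.
Proof.
by exists 0%N, (fun=> 0), (fun=> 0); split=> [[]|[]|] //; rewrite big_ord0.
Qed.

Lemma pure_spanD P Q u v :
  pure_span P Q u -> pure_span P Q v -> pure_span P Q (u + v).
Proof.
move=> [n [x [a [Px Qa ->]]]] [m [y [b [Py Qb ->]]]].
exists (n + m)%N, (fun i => match split i with inl i => x i | inr j => y j end),
  (fun i => match split i with inl i => a i | inr j => b j end).
split=> [i|i|]; try by case: (split i).
rewrite big_split_ord; congr (_ + _); apply: eq_bigr => i _.
  by rewrite (unsplitK (inl i : 'I_n + 'I_m)).
by rewrite (unsplitK (inr i : 'I_n + 'I_m)).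
Qed.

Lemma pure_span_sum P Q I (r : seq I) (F : I -> talg A) :
  (forall i, pure_span P Q (F i)) -> pure_span P Q (\sum_(i <- r) F i).
Proof.
by move=> h; elim/big_ind: _ => //; [apply: pure_span0 | apply: pure_spanD].
Qed.

Lemma pure_spanM P Q u v : GRing.subalg_closed P -> GRing.subalg_closed Q ->
  pure_span P Q u -> pure_span P Q v -> pure_span P Q (u * v).
Proof.
move=> [_ _ PM] [_ _ QM] [n [x [a [Px Qa ->]]]] [m [y [b [Py Qb ->]]]].
rewrite talg_sumM; apply: pure_span_sum => -[i j].
by apply: pure_span_pure; [apply: PM | apply: QM].
Qed.

Lemma pure_span_closed P Q : GRing.subalg_closed P -> GRing.subalg_closed Q ->
  GRing.subalg_closed [pred u : talg A | `[< pure_span P Q u >]].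
Proof.
move=> cP cQ; split=> [|a u v /asboolP hu /asboolP hv
  |u v /asboolP hu /asboolP hv].
- by apply/asboolP; apply: pure_span_pure; [case: cP | case: cQ].
- apply/asboolP/pure_spanD => //; have [n [x [y [Px Qy ->]]]] := hu.
  rewrite scaler_sumr; apply: pure_span_sum => i; rewrite -pureZl.
  apply: pure_span_pure => //; case: cP => P1 PL _.
  rewrite -[_ *: _]addr0; apply: (PL) => //.
  by rewrite -(subrr 1) addrC -scaleN1r; apply: (PL).
- exact/asboolP/pure_spanM.
Qed.

End PureSpan.

Lemma subalg_gen_ind (k : fieldType) (A : comAlgType k) (G : A -> Prop)
    (R : comAlgType k) (f : {lrmorphism A -> R}) (P : R -> Prop) :
  GRing.subalg_closed [pred u | `[< P u >]] -> (forall g, G g -> P (f g)) ->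
  forall a, a \in subalg_gen G -> P (f a).
Proof.
move=> [P1 PL PM] PG a /asboolP ha; apply/asboolP.
have cl : GRing.subalg_closed [pred a | `[< P (f a) >]].
  split=> [|c u v /asboolP hu /asboolP hv|u v /asboolP hu /asboolP hv].
  - by rewrite inE rmorph1.
  - by rewrite inE linearP; apply: PL; apply/asboolP.
  - by rewrite inE rmorphM; apply: PM; apply/asboolP.
by apply: (ha _ cl) => g /PG ?; apply/asboolP.
Qed.

Lemma subalg_ind (k : fieldType) (A : comAlgType k) (G : A -> Prop)
    (P : subalg G -> Prop) :
  P 1 -> (forall c u v, P u -> P v -> P (c *: u + v)) ->
  (forall u v, P u -> P v -> P (u * v)) ->
  (forall g (Gg : G g), P (subalg_elt Gg)) -> forall a, P a.
Proof.
move=> P1 PL PM PG b; have /asboolP hb := valP b.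
pose Q := [pred x | `[< exists2 c : subalg G, val c = x & P c >]].
suff /asboolP[c /val_inj -> //] : val b \in Q.
apply: hb => [|g Gg]; last by apply/asboolP; exists (subalg_elt Gg).
split=> [|a u v /asboolP[x <- Px] /asboolP[y <- Py]
  |u v /asboolP[x <- Px] /asboolP[y <- Py]]; apply/asboolP.
- by exists 1.
- by exists (a *: x + y); rewrite ?linearP //; apply: PL.
- by exists (x * y); rewrite ?rmorphM //; apply: PM.
Qed.

Section ScalarMorphism.
Variables (k : fieldType) (A : comAlgType k).

Lemma scalar_linear (eps : {lrmorphism A -> k^o}) :
  is_linear (fun a => (eps a : k)%:A : A).
Proof. by move=> a u v; rewrite linearP scalerDl scalerA. Qed.

Lemma scalar_monoid (eps : {lrmorphism A -> k^o}) :
  monoid_morphism (fun a => (eps a : k)%:A : A).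
Proof.
split=> [|a b]; first by rewrite rmorph1 scale1r.
by rewrite rmorphM -scalerAl mul1r scalerA.
Qed.

Definition scalar_alg (eps : {lrmorphism A -> k^o}) : {lrmorphism A -> A} :=
  HB.pack (fun a => (eps a : k)%:A : A)
    (GRing.isLinear.Build k A A *:%R _ (scalar_linear eps))
    (GRing.isMonoidMorphism.Build A A _ (scalar_monoid eps)).

End ScalarMorphism.

(** [rho] is the comultiplication and [rhoV] is [a |-> a_1 (x) S a_2]. The
    map [copair rho inr_alg], which sends [a (x) b] to [rho a * (1 (x) b)],
    is translation by the generic point of the second factor; [rhoVK] says
    that [rhoV] inverts it on the first factor. *)
Section HopfSubalgebra.
Variables (k : fieldType) (A : comAlgType k) (G : A -> Prop).
Hypothesis A_domain : forall a b : A, a * b = 0 -> a = 0 \/ b = 0.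
Variables (rho rhoV : {lrmorphism A -> talg A}) (eps : {lrmorphism A -> k^o}).
Variable S : {lrmorphism A -> A}.
Notation B := (subalg G).

Hypothesis counitE : forall a, copair (scalar_alg eps) idfun (rho a) = a.
Hypothesis antipodeE : forall a, copair idfun S (rho a) = scalar_alg eps a.
Hypothesis rhoVK : forall a, copair rho (@inr_alg k A) (rhoV a) = inl_alg a.

Hypothesis rhoG :
  forall g, G g -> pure_span (subalg_gen G) (subalg_gen G) (rho g).
Hypothesis rhoVG : forall g, G g -> pure_span (subalg_gen G) predT (rhoV g).
Hypothesis SG : forall g, G g -> S g \in subalg_gen G.

Let T := talg A.

Definition base_span (u : T) := pure_span (subalg_gen G) predT u.

Definition base_elt a (Ba : a \in subalg_gen G) : B := exist _ a Ba.

Lemma subalg_elim a : a \in subalg_gen G -> exists b : B, val b = a.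
Proof. by move=> Ba; exists (base_elt Ba). Qed.

Lemma predT_subalg_closed : GRing.subalg_closed (predT : {pred A}).
Proof. by []. Qed.

Lemma rhoB (b : B) : exists n (x y : 'I_n -> B),
  rho (val b) = \sum_i val (x i) \ot val (y i).
Proof.
have [n [x [y [Bx By ->]]]] := subalg_gen_ind (f := rho)
  (pure_span_closed (subalg_gen_closed G) (subalg_gen_closed G)) rhoG (valP b).
by exists n, (fun i => base_elt (Bx i)), (fun i => base_elt (By i)).
Qed.

Lemma base_span_rho (b : B) : base_span (rho (val b)).
Proof.
have [n [x [y ->]]] := rhoB b.
apply: pure_span_sum => i; apply: pure_span_pure; rewrite ?inE //.
exact: valP.
Qed.

Lemma rhoVB (b : B) : base_span (rhoV (val b)).
Proof.
apply: subalg_gen_ind rhoVG _ (valP b).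
exact: pure_span_closed (subalg_gen_closed G) predT_subalg_closed.
Qed.

Lemma SB (b : B) : exists b' : B, val b' = S (val b).
Proof.
apply: subalg_elim.
apply: (@subalg_gen_ind _ _ G _ S (fun a => a \in subalg_gen G)) SG _ (valP b).
have [g1 gL gM] := subalg_gen_closed G.
split=> [|c u v /asboolP hu /asboolP hv|u v /asboolP hu /asboolP hv];
  apply/asboolP; [exact: g1 | exact: gL | exact: gM].
Qed.

Lemma base_spanM u v : base_span u -> base_span v -> base_span (u * v).
Proof. exact: pure_spanM (subalg_gen_closed G) predT_subalg_closed. Qed.

Lemma base_span_inr a : base_span (inr_alg a).
Proof. by apply: pure_span_pure => //; case: (subalg_gen_closed G). Qed.

Lemma base_span_mulmx m n p (X : 'M[T]_(m, n)) (Y : 'M[T]_(n, p)) :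
  (forall i j, base_span (X i j)) -> (forall i j, base_span (Y i j)) ->
  forall i j, base_span ((X *m Y) i j).
Proof.
by move=> hX hY i j; rewrite mxE; apply: pure_span_sum => l; apply: base_spanM.
Qed.

Definition intoB (beta : {linear A -> A}) :=
  forall a, exists b : B, val b = beta a.

Lemma rcontract_base beta u : intoB beta -> base_span u ->
  exists b : B, val b = rcontract beta u.
Proof.
move=> hb [n [x [a [Bx _ ->]]]]; have [y hy] := choice (fun i => hb (a i)).
exists (\sum_i base_elt (Bx i) * y i); rewrite raddf_sum rcontract_sum.
by apply: eq_bigr => i _; rewrite rcontract_pure -hy.
Qed.

Lemma rcontract_base_mx beta m n (X : 'M[T]_(m, n)) : intoB beta ->
  (forall i j, base_span (X i j)) ->
  exists F : 'M[B]_(m, n), map_mx val F = map_mx (rcontract beta) X.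
Proof.
move=> hb hX.
have [F hF] := choice (fun ij : 'I_m * 'I_n =>
  rcontract_base hb (hX ij.1 ij.2)).
by exists (\matrix_(i, j) F (i, j)); apply/matrixP=> i j; rewrite !mxE hF.
Qed.

Lemma rcontract_mulmx beta m n p (X : 'M[A]_(m, n)) (Y : 'M[T]_(n, p)) :
  map_mx (rcontract beta) (map_mx (@inl_alg k A) X *m Y) =
  X *m map_mx (rcontract beta) Y.
Proof.
apply/matrixP=> i j; rewrite !mxE rcontract_sum; apply: eq_bigr => l _.
by rewrite !mxE rcontractMl.
Qed.

Lemma rcontract_mulmxr beta m n p (X : 'M[T]_(m, n)) (Y : 'M[A]_(n, p)) :
  map_mx (rcontract beta) (X *m map_mx (@inl_alg k A) Y) =
  map_mx (rcontract beta) X *m Y.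
Proof.
apply/matrixP=> i j; rewrite !mxE rcontract_sum; apply: eq_bigr => l _.
by rewrite !mxE mulrC rcontractMl mulrC.
Qed.

Lemma scalar_form_linear (lam : {linear A -> k^o}) :
  is_linear (fun a => (lam a : k)%:A : A).
Proof. by move=> a u v; rewrite linearP scalerDl scalerA. Qed.

Definition scalar_form lam := linmap (scalar_form_linear lam).

Lemma scalar_form_intoB lam : intoB (scalar_form lam).
Proof. by move=> a; exists (lam a : k)%:A. Qed.

Lemma rcontract_scalar lam a b :
  rcontract (scalar_form lam) (a \ot b) = (lam b : k) *: a.
Proof. by rewrite rcontract_pure /= mulr_algr. Qed.

(** The forms dual to the right family of a rank decomposition give back the
    left family as contractions. *)
Lemma talg_eq0 (u : T) :
  (forall lam, rcontract (scalar_form lam) u = 0) -> u = 0.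
Proof.
move=> u0; have [n [x [y [_ [lam [uE _ dlam]]]]]] := rank_decomposition u.
rewrite uE big1 // => i _.
have := u0 (lam i); rewrite uE rcontract_sum.
under eq_bigr => j _ do rewrite rcontract_scalar dlam.
by rewrite sum_delta => ->; rewrite pure0l.
Qed.

(** Let [b] be a nonzero element of a stable ideal [I]. Contracting [rho b]
    with a form [lam] such that [lam b = 1] gives [b1] in [I] with [eps b1 =
    1]. In an expansion [rho b1 = \sum_j e_j (x) y_j] with independent [y_j]
    in the base, the [e_j] are contractions of [rho b1], hence lie in [I];
    the antipode identity becomes [1 = \sum_j e_j * S y_j]. *)
Lemma stable_ideal_unit (I : B -> Prop) :
  (forall a b, I a -> I b -> I (a + b)) -> (forall a b, I b -> I (a * b)) ->
  (forall (beta : {linear A -> A}) (b b' : B), intoB beta -> I b ->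
     val b' = rcontract beta (rho (val b)) -> I b') ->
  forall b, b != 0 -> I b -> I 1.
Proof.
move=> ID IM Istable b b0 Ib.
have vb0 : val b != 0 by apply: contra_neq b0 => e; apply: val_inj.
have [phi lphi phib] := separating_form vb0; pose lam := linmap lphi.
have [b1 b1E] := rcontract_base (scalar_form_intoB lam) (base_span_rho b).
have I1 : I b1 := Istable _ _ _ (scalar_form_intoB lam) Ib b1E.
have eps_b1 : eps (val b1) = 1.
  rewrite b1E -phib -{2}[val b]counitE.
  have e : eps \o rcontract (scalar_form lam) =1
      lam \o copair (scalar_alg eps) idfun.
    apply: tensor_ext => x y.
    change (eps (rcontract (scalar_form lam) (x \ot y)) =
      lam (copair (scalar_alg eps) idfun (x \ot y))).
    rewrite rcontract_scalar copair_pure linearZ_LR.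
    rewrite -[RHS]/(lam ((eps x)%:A * y)).
    by rewrite mulr_algl linearZ_LR /= [LHS]mulrC.
  exact: e.
have [n [x [y rho_b1]]] := rhoB b1.
have [m [idx [la [_ yE]]]] := dual_family (fun i => val (y i)).
have [e eE] := choice (fun j =>
  rcontract_base (scalar_form_intoB (la j)) (base_span_rho b1)).
have [z zE] := choice (fun j => SB (y (idx j))).
suff -> : 1 = \sum_j z j * e j.
  have I0 : I 0 by rewrite -(mul0r b); apply: IM.
  elim/big_ind: _ => // j _; apply: IM.
  exact: Istable (scalar_form_intoB (la j)) I1 (eE j).
apply: val_inj; rewrite linear_sum /=.
have := antipodeE (val b1); rewrite /= eps_b1 scale1r => <-.
have -> : rho (val b1) = \sum_j val (e j) \ot val (y (idx j)).
  rewrite [LHS]rho_b1; under eq_bigr => i _ do rewrite yE pure_sumr.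
  rewrite exchange_big; apply: eq_bigr => j _; rewrite eE rho_b1 rcontract_sum.
  rewrite pure_suml; apply: eq_bigr => i _.
  by rewrite rcontract_scalar pureZr pureZl.
rewrite linear_sum; apply: eq_bigr => j _.
by rewrite [LHS]copair_pure zE mulrC.
Qed.

Section Subcomodule.
Variables (n : nat) (c : 'rV[A]_n) (M MV : 'M[A]_n).
Hypothesis MMV : M *m MV = 1%:M.
Hypothesis rho_c :
  map_mx rho c = map_mx (@inl_alg k A) c *m map_mx (@inr_alg k A) M.
Hypothesis rhoV_c :
  map_mx rhoV c = map_mx (@inl_alg k A) c *m map_mx (@inr_alg k A) MV.

(** A row that kills the relations of the [c j] is a linear form on the
    submodule generated by the [c j] over the base, given by its values at
    the [c j]. *)
Definition kills_relations m (F : 'M[B]_(m, n)) :=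
  forall b : 'cV[B]_n, c *m map_mx val b = 0 -> F *m b = 0.

(** The translates of the linear forms given by the rows of [F]. *)
Definition twist m (F : 'M[B]_(m, n)) : 'M[T]_(m, n) :=
  map_mx rho (map_mx val F) *m map_mx (@inr_alg k A) MV.

Lemma twist_base m (F : 'M[B]_(m, n)) i j : base_span (twist F i j).
Proof.
apply: base_span_mulmx => {}i {}j; rewrite !mxE; first exact: base_span_rho.
exact: base_span_inr.
Qed.

Lemma val_mx_inj m p : injective (map_mx val : 'M[B]_(m, p) -> 'M[A]_(m, p)).
Proof.
move=> X Y /matrixP e; apply/matrixP=> i j; apply: val_inj.
by have := e i j; rewrite !mxE.
Qed.

(** The relation [b] is translated back, by [rhoV], to a relation [g] with
    coefficients in the tensor square. All contractions of [g] are relations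
    over the base, so [F] kills [g]; translating the equation [F g = 0]
    forward gives the result. *)
Lemma twist_kills m (F : 'M[B]_(m, n)) (b : 'cV[B]_n) : kills_relations F ->
  c *m map_mx val b = 0 ->
  twist F *m map_mx (@inl_alg k A) (map_mx val b) = 0.
Proof.
move=> kF cb0.
pose g := map_mx (@inr_alg k A) MV *m map_mx rhoV (map_mx val b).
have g_base i j : base_span (g i j).
  apply: base_span_mulmx => {}i {}j; rewrite !mxE; first exact: base_span_inr.
  exact: rhoVB.
have cg : map_mx (@inl_alg k A) c *m g = 0.
  by rewrite mulmxA -rhoV_c -map_mxM cb0 map_mx0.
have Fg : map_mx (@inl_alg k A) (map_mx val F) *m g = 0.
  apply/matrixP => i j; rewrite [RHS]mxE; apply: talg_eq0 => lam.
  have [gl glE] := rcontract_base_mx (scalar_form_intoB lam) g_base.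
  have := congr1 (map_mx (rcontract (scalar_form lam))) cg.
  rewrite map_mx0 rcontract_mulmx -glE => /kF Fgl.
  have := rcontract_mulmx (scalar_form lam) (map_mx val F) g.
  rewrite -glE -map_mxM Fgl map_mx0 => /matrixP /(_ i j).
  by rewrite !mxE.
have := congr1 (map_mx (copair rho (@inr_alg k A))) Fg.
rewrite map_mx0 !map_mxM mulmxA => <-; congr (_ *m _ *m _).
- by apply/matrixP=> i j; rewrite !mxE; apply/esym/copair_inl.
- by apply/matrixP=> i j; rewrite !mxE; apply/esym/copair_inr.
- by apply/matrixP=> i j; rewrite !mxE; apply/esym/rhoVK.
Qed.

Lemma kills_relationsD m (F F' : 'M[B]_(m, n)) :
  kills_relations F -> kills_relations F' -> kills_relations (F + F').
Proof. by move=> kF kF' b cb; rewrite mulmxDl kF ?kF' ?addr0. Qed.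

Lemma kills_relationsZ m a (F : 'M[B]_(m, n)) :
  kills_relations F -> kills_relations (a *: F).
Proof. by move=> kF b cb; rewrite -scalemxAl kF ?scaler0. Qed.

Lemma kills_contract beta m (F : 'M[B]_(m, n)) (X : 'M[T]_(m, n)) :
  (forall b : 'cV[B]_n, c *m map_mx val b = 0 ->
     X *m map_mx (@inl_alg k A) (map_mx val b) = 0) ->
  map_mx val F = map_mx (rcontract beta) X -> kills_relations F.
Proof.
move=> kX FX b /kX /(congr1 (map_mx (rcontract beta))).
rewrite map_mx0 rcontract_mulmxr -FX -map_mxM => e.
by apply: val_mx_inj; rewrite e map_mx0.
Qed.

(** Multiplication by [b] on the submodule generated by the [c j] factors
    through a free module over the base; for [b = 1] the submodule is
    projective. *)
Definition splitting (b : B) :=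
  exists2 F : 'M[B]_n, kills_relations F & val b *: c = c *m map_mx val F.

(** Translating [b c = c F] gives [rho b * c = c * (M * rho F * M^-1)];
    contraction of the second factor brings this back to [A]. *)
Lemma splitting_stable beta (b b' : B) : intoB beta -> splitting b ->
  val b' = rcontract beta (rho (val b)) -> splitting b'.
Proof.
move=> hb [F kF bF] b'E.
pose X := map_mx (@inr_alg k A) M *m twist F.
have X_base i j : base_span (X i j).
  apply: base_span_mulmx => {}i {}j; last exact: twist_base.
  by rewrite mxE; apply: base_span_inr.
have [F' F'E] := rcontract_base_mx hb X_base.
exists F'.
  apply: (kills_contract _ F'E) => g cg.
  by rewrite -mulmxA twist_kills // mulmx0.
have bX : rho (val b) *: map_mx (@inl_alg k A) c = map_mx (@inl_alg k A) c *m X.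
  rewrite /X /twist !mulmxA -rho_c -map_mxM -bF map_mxZ rho_c -scalemxAl.
  by rewrite -mulmxA -map_mxM MMV map_mx1 mulmx1.
have := congr1 (map_mx (rcontract beta)) bX; rewrite rcontract_mulmx -F'E => <-.
apply/matrixP=> i j; rewrite !mxE b'E [RHS]/= mulrC [in RHS]mulrC.
exact/esym/rcontractMl.
Qed.

(** The values at [c j0] of the linear forms on the submodule generated by
    the [c j]. *)
Definition unimodular j0 (b : B) :=
  exists2 f : 'rV[B]_n, kills_relations f & f 0 j0 = b.

(** As [c j0] is invariant, the translate of the form [f] takes at [c j0]
    the value [rho (f (c j0))]. *)
Lemma unimodular_stable j0 beta (b b' : B) :
  (forall i, MV i j0 = (i == j0)%:R) ->
  intoB beta -> unimodular j0 b ->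
  val b' = rcontract beta (rho (val b)) -> unimodular j0 b'.
Proof.
move=> MV0 hb [f kf fb] b'E.
have [f' f'E] := rcontract_base_mx hb (twist_base f).
exists f'; first by apply: (kills_contract _ f'E) => g cg; apply: twist_kills.
apply: val_inj; rewrite b'E; have /matrixP/(_ 0 j0) := f'E.
rewrite !mxE => ->; congr rcontract.
rewrite (bigD1 j0) //= !mxE MV0 eqxx rmorph1 mulr1 fb big1 ?addr0 // => i ij.
by rewrite !mxE MV0 (negPf ij) rmorph0 mulr0.
Qed.

Lemma splittingD b b' : splitting b -> splitting b' -> splitting (b + b').
Proof.
move=> [F kF bF] [F' kF' bF']; exists (F + F'); first exact: kills_relationsD.
by rewrite map_mxD mulmxDr -bF -bF' -scalerDl.
Qed.

Lemma splittingM a b : splitting b -> splitting (a * b).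
Proof.
move=> [F kF bF]; exists (a *: F); first exact: kills_relationsZ.
by rewrite map_mxZ -scalemxAr -bF scalerA.
Qed.

Lemma unimodularD j0 b b' :
  unimodular j0 b -> unimodular j0 b' -> unimodular j0 (b + b').
Proof.
move=> [f kf <-] [f' kf' <-]; exists (f + f'); first exact: kills_relationsD.
by rewrite mxE.
Qed.

Lemma unimodularM j0 a b : unimodular j0 b -> unimodular j0 (a * b).
Proof.
by move=> [f kf <-]; exists (a *: f); [apply: kills_relationsZ | rewrite mxE].
Qed.

Definition relation (b : 'I_n -> B) := \sum_i val (b i) * c 0 i = 0.

Definition free_on (P : {set 'I_n}) := forall b : 'I_n -> B,
  (forall i, i \notin P -> b i = 0) -> relation b -> forall i, b i = 0.

Lemma B_domain (a b : B) : a != 0 -> b != 0 -> a * b != 0.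
Proof.
move=> a0 b0; apply/eqP => /(congr1 val) /= /A_domain [] e.
  by case/eqP: a0; apply: val_inj.
by case/eqP: b0; apply: val_inj.
Qed.

(** Let [P] index a maximal subfamily of the [c j] that is free over the
    base, and let [b] be a common denominator for the coordinates of all [c
    i] along it. The coordinates of [b * x] are linear in [x] because the
    subfamily is free, and [b] is nonzero because there are no zero
    divisors. *)
Lemma splitting_neq0 : exists2 b, b != 0 & splitting b.
Proof.
have free0 : `[< free_on set0 >].
  by apply/asboolP => b b0 _ i; rewrite b0 ?inE.
case: (@arg_maxnP _ _ (fun P => `[< free_on P >]) (fun P => #|P|) free0).
move=> P /asboolP freeP Pmax.
have dep i : exists db : B * ('I_n -> B),
    [/\ db.1 != 0, forall j, j \notin P -> db.2 j = 0
      & val db.1 * c 0 i = \sum_j val (db.2 j) * c 0 j].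
  have [iP|iP] := boolP (i \in P).
    exists (1, fun j => (j == i)%:R); split=> [|j jP|]; first exact: oner_neq0.
      by rewrite /=; case: eqP jP => // ->; rewrite iP.
    rewrite (bigD1 i) //= eqxx mul1r big1 ?addr0 ?mul1r // => j /negPf->.
    by rewrite mul0r.
  have : ~ free_on (i |: P).
    move=> /asboolP /Pmax; rewrite cardsU1 iP add1n => /(leq_trans (ltnSn _)).
    by rewrite ltnn.
  move=> /existsNP [b /not_implyP [bP /not_implyP [rb /existsNP [j bj]]]].
  have bi : b i != 0.
    apply/eqP => bi0; apply: bj; apply: freeP rb j => l lP.
    have [->|li] := eqVneq l i; first exact: bi0.
    by apply: bP; rewrite !inE negb_or li.
  exists (b i, fun j => if j == i then 0 else - b j); split=> // [l lP|].
    rewrite /=; case: eqVneq => // li; rewrite bP ?oppr0 //.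
    by rewrite !inE negb_or li.
  move: rb; rewrite /relation (bigD1 i) //= => /eqP.
  rewrite addr_eq0 => /eqP ->.
  rewrite [RHS](bigD1 i) //= eqxx mul0r add0r -sumrN; apply: eq_bigr => l li.
  by rewrite (negPf li) mulNr.
have [db dbP] := choice dep; pose d i := (db i).1.
exists (\prod_i d i).
  elim/big_ind: _ => [|a b|i _]; [exact: oner_neq0 | exact: B_domain |].
  by case: (dbP i).
pose F := \matrix_(j, i) ((\prod_(l | l != i) d l) * (db i).2 j).
have cF : val (\prod_i d i) *: c = c *m map_mx val F.
  apply/matrixP => z i; rewrite {z}ord1 !mxE.
  have [_ _ di] := dbP i.
  rewrite (bigD1 i) //= [val _ * val _]mulrC -mulrA di mulr_sumr.
  by apply: eq_bigr => j _; rewrite !mxE /= mulrA mulrC.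
exists F => // b cb; apply/matrixP => j z; rewrite {z}ord1 [RHS]mxE.
apply: (freeP (fun j => (F *m b) j 0)) => [l lP|].
  rewrite mxE big1 // => i _; rewrite mxE; have [_ -> // _] := dbP i.
  by rewrite mulr0 mul0r.
have : c *m map_mx val (F *m b) = 0.
  by rewrite map_mxM mulmxA -cF -scalemxAl cb scaler0.
move/matrixP/(_ 0 0); rewrite !mxE => e; rewrite /relation -[RHS]e.
by apply: eq_bigr => i _; rewrite [map_mx _ _ _ _]mxE mulrC.
Qed.

End Subcomodule.

Hypothesis locally_finite : forall a, in_subcomodule rho rhoV [:: a].

(** The rows of [F] with [c F = c] form a dual basis of the submodule [N]
    generated by the [c j], and [f] is a form on [N] with value [1] at [1]. *)
Theorem hopf_subalgebra_faithfully_flat : faithfully_flat (over_subalg G).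
Proof.
apply: (@locally_split_faithfully_flat B (over_subalg G) (1 : A)) => l.
have [n [c [M [MV [j0 [MMV rc rVc [c1 MV1] span]]]]]] :=
  in_subcomodule_mx (in_subcomodule_seq l locally_finite).
have [F kF cF] : splitting c 1.
  have [b b0 sb] := splitting_neq0 c.
  apply: stable_ideal_unit b0 sb; [exact: splittingD | exact: splittingM |].
  exact: (splitting_stable MMV rc rVc).
have {}cF : c *m map_mx val F = c by rewrite -cF scale1r.
have [f kf f1] : unimodular c j0 1.
  have [i Fi] : exists i, F i j0 != 0.
    apply: contrapT => /forallNP h.
    have /matrixP/(_ 0 j0) := cF; rewrite mxE c1 big1 => [/eqP|i _].
      by rewrite eq_sym oner_eq0.
    by rewrite mxE; have /negP := h i; rewrite negbK => /eqP ->; rewrite mulr0.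
  apply: stable_ideal_unit Fi _; [exact: unimodularD | exact: unimodularM | |].
    move=> beta b b'; apply: unimodular_stable MV1; exact: rVc.
  exists (row i F) => [b cb|]; last by rewrite mxE.
  by rewrite -row_mul kF ?row0.
pose N (m : over_subalg G) := exists v : 'cV[B]_n, m%:M = c *m map_mx val v.
have NE m (v : 'cV[B]_n) : m%:M = c *m map_mx val v <->
    m = \sum_i val (v i 0) * c 0 i.
  split=> [/matrixP/(_ 0 0)|->].
    rewrite !mxE mulr1n => ->; apply: eq_bigr => i _; by rewrite mxE mulrC.
  apply/matrixP=> i j; rewrite !ord1 !mxE mulr1n; apply: eq_bigr => h _.
  by rewrite mxE mulrC.
have vex (m : over_subalg G) :
    exists v : 'cV[B]_n, N m -> m%:M = c *m map_mx val v.
  by have [[v vm]|nN] := pselect (N m); [exists v | exists 0].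
have [v vP] := choice vex.
(* [v m] is some column of coordinates of [m]; by [unique] below, forms do
   not depend on its choice *)
pose fun_of (g : 'rV[B]_n) (m : over_subalg G) := (g *m v m) 0 0.
have subN : submodule N.
  split=> [|a x y [vx xE] [vy yE]].
    exists 0; rewrite map_mx0 mulmx0.
    by apply/matrixP=> i j; rewrite !mxE mul0rn.
  exists (a *: vx + vy); rewrite map_mxD map_mxZ mulmxDr -scalemxAr -xE -yE.
  by apply/matrixP => i j; rewrite !ord1 !mxE !mulr1n.
have unique (m : over_subalg G) (w : 'cV[B]_n) g : kills_relations c g ->
    m%:M = c *m map_mx val w -> fun_of g m = (g *m w) 0 0.
  move=> kg mw; have mv : m%:M = c *m map_mx val (v m) by apply: vP; exists w.
  have e : c *m map_mx val (v m - w) = 0.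
    by rewrite map_mxB mulmxBr -mv -mw subrr.
  by have /eqP := kg _ e; rewrite mulmxBr subr_eq0 /fun_of => /eqP ->.
have lin g : kills_relations c g -> functional_on N (fun_of g).
  move=> kg; split=> // a x y Nx Ny.
  rewrite (unique _ (a *: v x + v y)) //.
    by rewrite /fun_of mulmxDr -scalemxAr [LHS]mxE [X in X + _]mxE.
  rewrite map_mxD map_mxZ mulmxDr -scalemxAr -!vP //.
  by apply/matrixP => i j; rewrite !ord1 !mxE !mulr1n.
have Nc i : N (c 0 i).
  exists (delta_mx i 0); apply/NE.
  rewrite (bigD1 i) //= mxE !eqxx mul1r big1 ?addr0 // => j ji.
  by rewrite mxE (negPf ji) mul0r.
have N1 : N (1 : A) by rewrite -c1; apply: Nc.
exists N; split=> //.
- move=> m /span [w ->].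
  exists (\col_i (w i)%:A); apply/NE; apply: eq_bigr => i _.
  by rewrite mxE /= mulr_algl.
- exists n, (fun i => c 0 i : over_subalg G), (fun i => fun_of (row i F)).
  split=> // [i|m Nm].
    by apply: lin => b cb; rewrite -row_mul kF ?row0.
  have /NE mE : m%:M = c *m map_mx val (F *m v m).
    by rewrite map_mxM mulmxA cF; apply: vP.
  rewrite [LHS]mE.
  apply: eq_bigr => i _; congr (val _ * _).
  rewrite /fun_of -row_mul. by rewrite [RHS]mxE.
- exists (fun_of f); first exact: lin.
  rewrite (unique _ (delta_mx j0 0)) //; last first.
    apply/NE; rewrite (bigD1 j0) //= mxE !eqxx mul1r c1 big1 ?addr0 // => j ji.
    by rewrite mxE (negPf ji) mul0r.
  by rewrite -colE mxE.
Qed.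

End HopfSubalgebra.

(** * Algebra maps out of the localized symmetric algebra *)

Section Sweedler.
Variables (k : fieldType) (C : coalgType k).

Lemma sweedler_sum (P : lmodType k) (F : C -> C -> P) (x : C)
    (I : finType) (y z : I -> C) :
  is_bilinear F -> comul x = \sum_i y i \ot z i ->
  sweedler x F = \sum_i F (y i) (z i).
Proof.
move=> bF xE; rewrite /sweedler -[tlift F]/(linmap (tlift_linear bF) : _ -> _).
by rewrite xE linear_sum; apply: eq_bigr => i _; apply: tlift_pure.
Qed.

Lemma mul_bilinear (R : comAlgType k) (V W : lmodType k) (f : {linear V -> R})
  (g : {linear W -> R}) : is_bilinear (fun x y => f x * g y).
Proof.
split=> [y a u v|x a u v]; first by rewrite linearP mulrDl -scalerAl.
by rewrite linearP mulrDr -scalerAr.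
Qed.

Definition conv_inverse (R : comAlgType k) (f g : {linear C -> R}) :=
  forall x, sweedler x (fun x1 x2 => f x1 * g x2) = (counit x : k)%:A.

Lemma conv_inverse_mx (R : comAlgType k) (f g : {linear C -> R}) n
    (m : 'I_n -> 'I_n -> C) : conv_inverse f g -> matrix_coalg m ->
  (\matrix_(i, j) f (m i j)) *m (\matrix_(i, j) g (m i j)) = 1%:M.
Proof.
move=> fg [comulm counitm]; apply/matrixP => i j; rewrite !mxE.
have := fg (m i j); rewrite (sweedler_sum (mul_bilinear f g) (comulm i j)).
rewrite counitm scaler_nat => <-.
by apply: eq_bigr => l _; rewrite !mxE.
Qed.

Lemma matrix_coalg_span (x : C) :
  exists n (m : 'I_n -> 'I_n -> C) (a : 'I_n -> 'I_n -> k),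
  matrix_coalg m /\ x = \sum_i \sum_j a i j *: m i j.
Proof.
have [n [h [m [a [xE hE mm]]]]] := coalgebra_finiteness x.
exists n, m, (fun i j => a j * counit (h i)); split=> //.
rewrite xE exchange_big; apply: eq_bigr => j _.
have cj : lslice C counit (comul (h j)) = h j := counitl (h j).
rewrite -[in LHS]cj hE (linear_sum (lslice C counit)) scaler_sumr.
by apply: eq_bigr => i _; rewrite lslice_pure scalerA.
Qed.

End Sweedler.

Definition symL (k : fieldType) (V : lmodType k) (R : comAlgType k)
    (f : {linear V -> R}) : {lrmorphism Sym V -> R} :=
  let: And3 lin mon _ := sym_liftP (linear_is_linear f) in
  HB.pack (sym_lift f) (GRing.isLinear.Build k (Sym V) R *:%R (sym_lift f) lin)
    (GRing.isMonoidMorphism.Build (Sym V) R (sym_lift f) mon).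

Lemma symL_gen (k : fieldType) (V : lmodType k) (R : comAlgType k)
  (f : {linear V -> R}) v : symL f (sgen v) = f v.
Proof.
rewrite /symL; case: (sym_liftP _) => lin mon gen; exact: gen.
Qed.

Lemma symLM (k : fieldType) (V : lmodType k) (R : comAlgType k)
  (f : {linear V -> R}) p q : symL f (p * q) = symL f p * symL f q.
Proof. exact: (rmorphM (symL f)). Qed.

Lemma symLP (k : fieldType) (V : lmodType k) (R : comAlgType k)
  (f : {linear V -> R}) a p q : symL f (a *: p + q) = a *: symL f p + symL f q.
Proof. exact: (linearP (symL f)). Qed.

Lemma lrmorph_eq_fraction (k : fieldType) (A R : comAlgType k)
    (F G : {lrmorphism A -> R}) (a d p r : A) :
  a * d = p -> r * d = 1 -> F d = G d -> F p = G p -> F a = G a.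
Proof.
move=> ad rd Fd Fp.
have ar : a = p * r by rewrite -ad -mulrA [d * r]mulrC rd mulr1.
have FM u v : F (u * v) = F u * F v := rmorphM F u v.
have GM u v : G (u * v) = G u * G v := rmorphM G u v.
rewrite ar FM GM Fp; congr (_ * _).
have Fr : F r * F d = 1 by rewrite -FM rd rmorph1.
have Gr : G r * F d = 1 by rewrite Fd -GM rd rmorph1.
by rewrite -[LHS]mulr1 -Gr mulrCA Fr mulr1.
Qed.

Section Theta.
Variables (k : fieldType) (H : hopfAlgType k) (tinv : {linear H -> FracSym H}).
Hypothesis tinvP : is_tgen_inverse tinv.
Notation A := (STheta tinv).

Lemma t_linear : is_linear (t_ tinv : H -> A).
Proof.
move=> a u v; apply: val_inj; rewrite /= /tgen.
by rewrite linearP [LHS]linearP.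
Qed.
Lemma tV_linear : is_linear (tV_ tinv : H -> A).
Proof. by move=> a u v; apply: val_inj; rewrite /= linearP. Qed.
Definition tL := linmap t_linear.
Definition tVL := linmap tV_linear.

Lemma t_tV_inverse : conv_inverse tL tVL.
Proof.
move=> x; apply: val_inj; rewrite linearZ_LR rmorph1 -(tinvP x).1.
by rewrite /sweedler /tlift /fsum linear_sum.
Qed.

Lemma tV_t_inverse : conv_inverse tVL tL.
Proof.
move=> x; apply: val_inj; rewrite linearZ_LR rmorph1 -(tinvP x).2.
by rewrite /sweedler /tlift /fsum linear_sum.
Qed.

(** The denominators that become invertible at every convolution invertible
    linear map, hence are allowed in [S(t_H)_Theta]. *)
Definition universal_unit (d : Sym H) :=
  forall (R : comAlgType k) (f g : {linear H -> R}),
  conv_inverse f g -> exists r, r * symL f d = 1.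

Lemma universal_unit1 : universal_unit 1.
Proof. by move=> R f g _; exists 1; rewrite rmorph1 mulr1. Qed.

Lemma universal_unitM d e :
  universal_unit d -> universal_unit e -> universal_unit (d * e).
Proof.
move=> gd ge R f g fg; have [r rd] := gd R f g fg; have [s se] := ge R f g fg.
by exists (r * s); rewrite rmorphM mulrACA rd se mulr1.
Qed.

Lemma universal_unit_det n (m : 'I_n -> 'I_n -> H) : matrix_coalg m ->
  universal_unit (\det (\matrix_(i, j) sgen (m i j))).
Proof.
move=> mm R f g fg; exists (\det (\matrix_(i, j) g (m i j))).
rewrite -det_map_mx; have -> : map_mx (symL f) (\matrix_(i, j) sgen (m i j)) =
    \matrix_(i, j) f (m i j) by apply/matrixP=> i j; rewrite !mxE symL_gen.
by rewrite mulrC -det_mulmx (conv_inverse_mx fg mm) det1.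
Qed.

Definition fraction_of (x : FracSym H) (d p : Sym H) :=
  universal_unit d /\ x * frac_sym d = frac_sym p.

Lemma frac_symM (p q : Sym H) : frac_sym (p * q) = frac_sym p * frac_sym q.
Proof. exact: (rmorphM (@frac_sym k H)). Qed.

Lemma frac_symP a (p q : Sym H) :
  frac_sym (a *: p + q) = a *: frac_sym p + frac_sym q.
Proof. exact: (linearP (@frac_sym k H)). Qed.

Lemma fraction_ofP a x y dx px dy py :
  fraction_of x dx px -> fraction_of y dy py ->
  fraction_of (a *: x + y) (dx * dy) (a *: (px * dy) + py * dx).
Proof.
move=> [gx xE] [gy yE]; split; first exact: universal_unitM.
rewrite frac_symP !frac_symM -xE -yE mulrDl -scalerAl.
by congr (_ *: _ + _); rewrite mulrA // mulrAC.
Qed.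

Lemma fraction_ofM x y dx px dy py :
  fraction_of x dx px -> fraction_of y dy py ->
  fraction_of (x * y) (dx * dy) (px * py).
Proof.
move=> [gx xE] [gy yE]; split; first exact: universal_unitM.
by rewrite !frac_symM mulrACA xE yE.
Qed.

Lemma fraction_of_sym p : fraction_of (frac_sym p) 1 p.
Proof. by split; [exact: universal_unit1 | rewrite rmorph1 mulr1]. Qed.

(** By Cramer's rule: [t^-1] at the entries of a multiplicative matrix [m]
    is the inverse of the matrix [t] at the entries of [m]. *)
Lemma fraction_of_tinv x : exists d p, fraction_of (tinv x) d p.
Proof.
have [n [m [a [mm ->]]]] := matrix_coalg_span x.
pose P y := exists d p, fraction_of (tinv y) d p.
have P0 : P 0.
  exists 1, 0; rewrite raddf0 -(rmorph0 (@frac_sym _ H)).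
  exact: fraction_of_sym.
have PD b y z : P y -> P z -> P (b *: y + z).
  move=> [d [p hy]] [e [q hz]]; rewrite /P linearP.
  by eexists; eexists; apply: fraction_ofP hy hz.
have PS I (r : seq I) F : (forall i, P (F i)) -> P (\sum_(i <- r) F i).
  move=> PF; elim/big_ind: _ => // y z Py Pz.
  by rewrite -[y]scale1r; apply: PD.
apply: (PS) => i; apply: (PS) => j; rewrite -[_ *: _]addr0; apply: PD => //.
pose Mt := \matrix_(i, j) sgen (m i j).
exists (\det Mt), (\adj Mt i j); split; first exact: universal_unit_det.
pose Mv : 'M[A]_n := \matrix_(i, j) tVL (m i j).
have MM := conv_inverse_mx t_tV_inverse mm.
have := congr1 (map_mx val) MM; rewrite map_mxM map_mx1.
have -> : map_mx val (\matrix_(i, j) tL (m i j)) = map_mx (@frac_sym _ H) Mt.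
  by apply/matrixP=> r s; rewrite !mxE.
move/(congr1 (mulmx (map_mx (@frac_sym _ H) (\adj Mt)))).
rewrite mulmx1 mulmxA -map_mxM mul_adj_mx map_scalar_mx mul_scalar_mx.
by move/matrixP/(_ i j); rewrite !mxE => <-; rewrite mulrC.
Qed.

Lemma fraction_ex (a : A) : exists d p, fraction_of (val a) d p.
Proof.
case: a => a /= /asboolP ha.
pose P := [pred x | `[< exists d p, fraction_of x d p >]].
suff : a \in P by move/asboolP.
apply: ha => [|g [x|x]]; last 2 first.
- by apply/asboolP; exists 1, (sgen x); apply: fraction_of_sym.
- exact/asboolP/fraction_of_tinv.
split=> [|c x y /asboolP [d [p hx]] /asboolP [e [q hy]]
  |x y /asboolP [d [p hx]] /asboolP [e [q hy]]]; apply/asboolP.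
- by exists 1, 1; rewrite -(rmorph1 (@frac_sym _ H)); apply: fraction_of_sym.
- by eexists; eexists; apply: fraction_ofP hx hy.
- by eexists; eexists; apply: fraction_ofM hx hy.
Qed.

Lemma frac_sym_inj : injective (@frac_sym k H).
Proof. by move=> p q /eqP; rewrite [_ == _]tofrac_eq => /eqP. Qed.

Section Extension.
Variables (R : comAlgType k) (f g : {linear H -> R}).
Hypothesis fg : conv_inverse f g.

Definition value_at (a : A) (r : R) :=
  exists d p, fraction_of (val a) d p /\ r * symL f d = symL f p.

Lemma value_ex a : exists r, value_at a r.
Proof.
have [d [p [gd dp]]] := fraction_ex a; have [s sd] := gd R f g fg.
by exists (symL f p * s), d, p; rewrite -mulrA sd mulr1.
Qed.

Lemma value_unique a r s : value_at a r -> value_at a s -> r = s.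
Proof.
move=> [d [p [[gd dp] rE]]] [e [q [[ge eq] sE]]].
have pe : p * e = q * d.
  by apply: frac_sym_inj; rewrite !frac_symM -dp -eq mulrAC.
have [u ud] := universal_unitM gd ge fg.
suff h : r * symL f (d * e) = s * symL f (d * e).
  by rewrite -[r]mulr1 -[s]mulr1 -ud mulrCA h mulrCA.
rewrite rmorphM mulrA rE [symL f d * _]mulrC mulrA sE -!rmorphM.
by rewrite pe.
Qed.

Definition extension (a : A) : R := sval (cid (value_ex a)).

Lemma extensionE a r : value_at a r -> extension a = r.
Proof. by rewrite /extension; case: cid => s /= hs /(value_unique hs). Qed.

Lemma extension_value a : value_at a (extension a).
Proof. by rewrite /extension; case: cid. Qed.

Lemma extension_linear : is_linear extension.
Proof.
move=> c a b; apply: extensionE.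
have [d [p [hd rE]]] := extension_value a.
have [e [q [he sE]]] := extension_value b.
exists (d * e), (c *: (p * e) + q * d); split; first exact: fraction_ofP.
rewrite symLP !symLM -rE -sE mulrDl -scalerAl.
by congr (_ *: _ + _); rewrite mulrA // mulrAC.
Qed.

Lemma extension_monoid : monoid_morphism extension.
Proof.
split=> [|a b]; apply: extensionE.
  exists 1, 1; rewrite !rmorph1 mulr1; split=> //.
  by rewrite -(rmorph1 (@frac_sym _ H)); apply: fraction_of_sym.
have [d [p [hd rE]]] := extension_value a.
have [e [q [he sE]]] := extension_value b.
exists (d * e), (p * q); split.
  have -> : val (a * b) = val a * val b by rewrite rmorphM.
  exact: fraction_ofM.
by rewrite !symLM mulrACA rE sE.
Qed.

(** The extension of [f] to the symmetric algebra inverts all denominators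
    that occur in [S(t_H)_Theta], so it extends to the fractions. *)
Lemma STheta_lift : exists F : {lrmorphism A -> R}, forall x, F (tL x) = f x.
Proof.
pose F : {lrmorphism A -> R} := HB.pack extension
  (GRing.isLinear.Build k A R *:%R extension extension_linear)
  (GRing.isMonoidMorphism.Build A R extension extension_monoid).
exists F; move=> x; apply: extensionE; exists 1, (sgen x).
split; first exact: fraction_of_sym.
by rewrite rmorph1 mulr1 symL_gen.
Qed.

End Extension.

Lemma STheta_ext (R : comAlgType k) (F G : {lrmorphism A -> R}) :
  (forall x, F (tL x) = G (tL x)) -> F =1 G.
Proof.
move=> FG a; have [d [p [gd dp]]] := fraction_ex a.
have iE q : val (symL tL q) = frac_sym q.
  have vl : is_linear (fun a : A => val a) by [].
  have vm : monoid_morphism (fun a : A => val a).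
    by split=> [|b c]; [rewrite rmorph1 | rewrite rmorphM].
  pose v : {lrmorphism A -> FracSym H} := HB.pack (fun a : A => val a)
    (GRing.isLinear.Build k A (FracSym H) *:%R _ vl)
    (GRing.isMonoidMorphism.Build A (FracSym H) _ vm).
  have e : v \o symL tL =1 @frac_sym k H.
    by apply: sym_ext => x; rewrite /= symL_gen.
  exact: e.
have FGs q : F (symL tL q) = G (symL tL q).
  have e : F \o symL tL =1 G \o symL tL.
    by apply: sym_ext => v; rewrite /= symL_gen.
  exact: e.
have ad : a * symL tL d = symL tL p by apply: val_inj; rewrite rmorphM /= !iE.
have [r rd] := gd A _ _ t_tV_inverse.
exact: lrmorph_eq_fraction ad rd (FGs d) (FGs p).
Qed.

End Theta.

(** * Convolution as matrix multiplication *)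

Section Convolution.
Variables (k : fieldType) (C : coalgType k) (R : comAlgType k).

Lemma conv_linear (f g : {linear C -> R}) :
  is_linear (fun x => sweedler x (fun x1 x2 => f x1 * g x2)).
Proof.
move=> a u v; rewrite /sweedler linearP.
exact: (tlift_linear (mul_bilinear f g)).
Qed.

Definition conv (f g : {linear C -> R}) := linmap (conv_linear f g).

(** Evaluation at a multiplicative matrix turns convolution into the product
    of matrices; cocommutativity makes these matrices commute. As the
    entries of multiplicative matrices span [C], identities between
    convolutions can be proved by matrix algebra. *)
Definition ev_mx n (m : 'I_n -> 'I_n -> C) (f : C -> R) : 'M[R]_n :=
  \matrix_(i, j) f (m i j).

Lemma linear_ext_coalg (f g : {linear C -> R}) :
  (forall n (m : 'I_n -> 'I_n -> C), matrix_coalg m -> ev_mx m f = ev_mx m g) ->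
  f =1 g.
Proof.
move=> fg x; have [n [m [a [mm ->]]]] := matrix_coalg_span x.
rewrite !linear_sum; apply: eq_bigr => i _.
rewrite !linear_sum; apply: eq_bigr => j _; rewrite !linearZ_LR.
by have /matrixP/(_ i j) := fg n m mm; rewrite !mxE => ->.
Qed.

Section Matrix.
Variables (n : nat) (m : 'I_n -> 'I_n -> C).
Hypothesis mm : matrix_coalg m.

Lemma ev_mx_conv (f g : {linear C -> R}) :
  ev_mx m (conv f g) = ev_mx m f *m ev_mx m g.
Proof.
apply/matrixP => i j; rewrite !mxE.
rewrite [LHS](sweedler_sum (mul_bilinear f g) (mm.1 i j)).
by apply: eq_bigr => l _; rewrite !mxE.
Qed.

Lemma ev_mx_inverse (f g : {linear C -> R}) :
  conv_inverse f g -> ev_mx m f *m ev_mx m g = 1%:M.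
Proof. by move=> fg; apply: conv_inverse_mx. Qed.

Lemma cocommutative_swap (P : lmodType k) (F : C -> C -> P) i j :
  cocommutative C -> is_bilinear F ->
  \sum_l F (m i l) (m l j) = \sum_l F (m l j) (m i l).
Proof.
move=> coC bF.
have bF' : is_bilinear (fun x y => F y x) by case: bF => l r; split.
have sb : is_bilinear (fun x y : C => y \ot x).
  by case: (pure_bilinear C C) => l r; split.
have e : linmap (tlift_linear bF) \o linmap (tlift_linear sb) =1
    linmap (tlift_linear bF').
  by apply: tensor_ext => x y; rewrite /= !tlift_pure.
rewrite -(sweedler_sum bF' (mm.1 i j)) -(sweedler_sum bF (mm.1 i j)).
by rewrite /sweedler -{1}coC; exact: e.
Qed.

Lemma ev_mxC (f g : {linear C -> R}) : cocommutative C ->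
  ev_mx m f *m ev_mx m g = ev_mx m g *m ev_mx m f.
Proof.
move=> coC; apply/matrixP => i j; rewrite !mxE.
transitivity (\sum_l f (m i l) * g (m l j)).
  by apply: eq_bigr => l _; rewrite !mxE.
rewrite (cocommutative_swap i j coC (mul_bilinear f g)).
by apply: eq_bigr => l _; rewrite !mxE mulrC.
Qed.

End Matrix.

Lemma conv_inverseP (f g : {linear C -> R}) :
  (forall n (m : 'I_n -> 'I_n -> C), matrix_coalg m ->
     ev_mx m f *m ev_mx m g = 1%:M) -> conv_inverse f g.
Proof.
move=> fg x.
have el : is_linear (fun x : C => (counit x : k)%:A : R).
  by move=> a u v; rewrite linearP scalerDl scalerA.
suff : conv f g =1 linmap el by move=> e; exact: e.
apply: linear_ext_coalg => n m mm; rewrite ev_mx_conv // fg //.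
by apply/matrixP=> i j; rewrite !mxE /= mm.2 scaler_nat.
Qed.

End Convolution.

Arguments ev_mx {k C R n} m f.

Section BilinearConvolution.
Variables (k : fieldType) (H : hopfAlgType k) (R : comAlgType k).

Definition conv2 (F G : H -> H -> R) (x y : H) : R :=
  sweedler x (fun x1 x2 => sweedler y (fun y1 y2 => F x1 y1 * G x2 y2)).

Lemma ext_mul_bilinear (f g : {linear H -> R}) :
  is_bilinear (fun x y => f x * g y).
Proof. exact: mul_bilinear. Qed.

Lemma comp_mul_bilinear (f : {linear H -> R}) :
  is_bilinear (fun x y => f (x * y)).
Proof.
by split=> [y a u v|x a u v];
   rewrite (mulrDl, mulrDr) -(scalerAl, scalerAr) linearP.
Qed.

Lemma conv2_bilinear1 (F G : H -> H -> R) : is_bilinear F -> is_bilinear G ->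
  forall x1 x2, is_bilinear (fun y1 y2 => F x1 y1 * G x2 y2).
Proof.
move=> bF bG x1 x2.
exact: (mul_bilinear (linmap (bF.2 x1)) (linmap (bG.2 x2))).
Qed.

Lemma conv2_bilinear2 (F G : H -> H -> R) : is_bilinear F -> is_bilinear G ->
  forall y, is_bilinear (fun x1 x2 =>
    sweedler y (fun y1 y2 => F x1 y1 * G x2 y2)).
Proof.
move=> bF bG y; split=> [x2 a u v|x1 a u v];
rewrite /sweedler /tlift /fsum scaler_sumr -big_split; apply: eq_bigr => p _ /=.
  by rewrite bF.1 mulrDl -scalerAl.
by rewrite bG.1 mulrDr -scalerAr.
Qed.

Lemma conv2_bilinear (F G : H -> H -> R) : is_bilinear F -> is_bilinear G ->
  is_bilinear (conv2 F G).
Proof.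
move=> bF bG; split=> [y a u v|x a u v].
  rewrite /conv2 /sweedler linearP.
  exact: (tlift_linear (conv2_bilinear2 bF bG y)).
rewrite /conv2 {1 3 5}/sweedler /tlift /fsum scaler_sumr -big_split.
apply: eq_bigr => p _ /=; rewrite /sweedler linearP.
exact: (tlift_linear (conv2_bilinear1 bF bG _ _)).
Qed.

Section Matrix.
Variables (n n' : nat) (m : 'I_n -> 'I_n -> H) (m' : 'I_n' -> 'I_n' -> H).
Hypotheses (mm : matrix_coalg m) (mm' : matrix_coalg m').

Let I : finType := ('I_n * 'I_n')%type.

(** The tensors [m i j (x) m' i' j'] form a multiplicative matrix of the
    coalgebra [H (x) H], indexed by pairs. *)
Definition ev2_mx (F : H -> H -> R) : 'M[R]_#|I| :=
  \matrix_(u, v) F (m (enum_val u).1 (enum_val v).1)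
                   (m' (enum_val u).2 (enum_val v).2).

Lemma ev2_mxM (F G : H -> H -> R) u v : (ev2_mx F *m ev2_mx G) u v =
  \sum_l \sum_c F (m (enum_val u).1 l) (m' (enum_val u).2 c) *
                G (m l (enum_val v).1) (m' c (enum_val v).2).
Proof.
rewrite mxE pair_bigA (reindex (@enum_val I predT)) /=; last first.
  by apply: onW_bij; apply: enum_val_bij.
by apply: eq_bigr => h _; rewrite !mxE.
Qed.

Lemma ev2_mx_conv (F G : H -> H -> R) : is_bilinear F -> is_bilinear G ->
  ev2_mx (conv2 F G) = ev2_mx F *m ev2_mx G.
Proof.
move=> bF bG; apply/matrixP => u v; rewrite ev2_mxM mxE /conv2.
rewrite (sweedler_sum (conv2_bilinear2 bF bG _) (mm.1 _ _)).
apply: eq_bigr => l _.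
by rewrite (sweedler_sum (conv2_bilinear1 bF bG _ _) (mm'.1 _ _)).
Qed.

Lemma ev2_mxC (F G : H -> H -> R) : cocommutative H ->
  is_bilinear F -> is_bilinear G ->
  ev2_mx F *m ev2_mx G = ev2_mx G *m ev2_mx F.
Proof.
move=> coC bF bG; apply/matrixP => u v; rewrite !ev2_mxM exchange_big.
transitivity (\sum_c \sum_l F (m l (enum_val v).1) (m' (enum_val u).2 c) *
                G (m (enum_val u).1 l) (m' c (enum_val v).2)).
  apply: eq_bigr => c _; apply: (cocommutative_swap mm _ _ coC
    (mul_bilinear (linmap (bF.1 _)) (linmap (bG.1 _)))).
rewrite exchange_big; apply: eq_bigr => l _.
have /= -> := cocommutative_swap mm' (enum_val u).2 (enum_val v).2 coC
  (mul_bilinear (linmap (bF.2 (m l (enum_val v).1)))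
                (linmap (bG.2 (m (enum_val u).1 l)))).
by apply: eq_bigr => c _; rewrite mulrC.
Qed.

Lemma ev2_mx_ext (f f' g g' : {linear H -> R}) :
  ev2_mx (fun x y => conv f f' x * conv g g' y) =
  ev2_mx (fun x y => f x * g y) *m ev2_mx (fun x y => f' x * g' y).
Proof.
apply/matrixP => u v; rewrite ev2_mxM mxE.
have /matrixP/(_ (enum_val u).1 (enum_val v).1) := ev_mx_conv mm f f'.
have /matrixP/(_ (enum_val u).2 (enum_val v).2) := ev_mx_conv mm' g g'.
rewrite !mxE => -> ->; rewrite mulr_suml; apply: eq_bigr => l _.
by rewrite mulr_sumr; apply: eq_bigr => c _; rewrite !mxE mulrACA.
Qed.

Lemma ev2_mx_mul (f g : {linear H -> R}) :
  ev2_mx (fun x y => conv f g (x * y)) =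
  ev2_mx (fun x y => f (x * y)) *m ev2_mx (fun x y => g (x * y)).
Proof.
apply/matrixP => u v; rewrite ev2_mxM mxE pair_bigA.
by apply: (sweedler_sum (mul_bilinear f g)); rewrite comulM mm.1 mm'.1 tmul_sum.
Qed.

End Matrix.
Lemma bilinear_ext_coalg (F G : H -> H -> R) x y :
  is_bilinear F -> is_bilinear G ->
  (forall n (m : 'I_n -> 'I_n -> H) n' (m' : 'I_n' -> 'I_n' -> H),
    matrix_coalg m -> matrix_coalg m' ->
    ev2_mx m m' F = ev2_mx m m' G) ->
  F x y = G x y.
Proof.
move=> bF bG FG; have [n' [m' [a' [mm' ->]]]] := matrix_coalg_span y.
rewrite -[F x]/(linmap (bF.2 x) : _ -> _) -[G x]/(linmap (bG.2 x) : _ -> _).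
rewrite !linear_sum; apply: eq_bigr => i' _.
rewrite !linear_sum; apply: eq_bigr => j' _; rewrite !linearZ_LR.
congr (_ *: _).
have [n [m [a [mm ->]]]] := matrix_coalg_span x.
rewrite -[LHS]/(linmap (bF.1 (m' i' j')) _) -[RHS]/(linmap (bG.1 (m' i' j')) _).
rewrite !linear_sum; apply: eq_bigr => i _.
rewrite !linear_sum; apply: eq_bigr => j _; rewrite !linearZ_LR; congr (_ *: _).
have /matrixP/(_ (enum_rank (i, i')) (enum_rank (j, j'))) := FG _ _ _ _ mm mm'.
by rewrite !mxE !enum_rankK.
Qed.

End BilinearConvolution.

(** * Coboundaries *)

Section Coboundary.
Variables (k : fieldType) (H : hopfAlgType k).
Hypothesis coH : cocommutative H.

Section Fixed.
Variable R : comAlgType k.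

Lemma conv_inverse_conv (f g f' g' : {linear H -> R}) :
  conv_inverse f f' -> conv_inverse g g' ->
  conv_inverse (conv f g) (conv f' g').
Proof.
move=> ff gg; apply: conv_inverseP => n m mm; rewrite !ev_mx_conv //.
rewrite (ev_mxC mm f' g' coH) mulmxA -[X in X *m _]mulmxA.
by rewrite (ev_mx_inverse mm gg) mulmx1 (ev_mx_inverse mm ff).
Qed.

Lemma conv_cancel (f g g' : {linear H -> R}) :
  conv_inverse g g' -> conv (conv f g) g' =1 f.
Proof.
move=> gg; apply: linear_ext_coalg => n m mm; rewrite !ev_mx_conv //.
by rewrite -mulmxA (ev_mx_inverse mm gg) mulmx1.
Qed.

Lemma conv_counit (f g : {linear H -> R}) :
  (forall x, f x = (counit x : k)%:A) -> conv f g =1 g.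
Proof.
move=> fe; apply: linear_ext_coalg => n m mm; rewrite ev_mx_conv //.
suff -> : ev_mx m f = 1%:M by rewrite mul1mx.
by apply/matrixP=> i j; rewrite !mxE fe mm.2 scaler_nat.
Qed.

(** For [g] the convolution inverse of [f], the coboundary of [f] and its
    inverse. *)
Definition cobound (f g : {linear H -> R}) : H -> H -> R :=
  conv2 (fun x y => f x * f y) (fun x y => g (x * y)).
Definition coboundV (f g : {linear H -> R}) : H -> H -> R :=
  conv2 (fun x y => f (x * y)) (fun x y => g x * g y).

Lemma cobound_bilinear f g : is_bilinear (cobound f g).
Proof. exact: conv2_bilinear (ext_mul_bilinear f f) (comp_mul_bilinear g). Qed.
Lemma coboundV_bilinear f g : is_bilinear (coboundV f g).
Proof. exact: conv2_bilinear (comp_mul_bilinear f) (ext_mul_bilinear g g). Qed.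

Lemma coboundC f g x y : cobound f g x y = coboundV g f x y.
Proof.
apply: bilinear_ext_coalg; first exact: cobound_bilinear.
  exact: coboundV_bilinear.
move=> n m n' m' mm mm'.
have e := ext_mul_bilinear f f; have c := comp_mul_bilinear g.
rewrite (ev2_mx_conv mm mm' e c) (ev2_mx_conv mm mm' c e).
exact: ev2_mxC.
Qed.

(** The two factors of the coboundary, [f x * f y] and [g (x * y)], are
    multiplicative in [f] and in [g] for convolution on [H (x) H]; by
    cocommutativity the factors can be regrouped. *)
Lemma cobound_conv f g f' g' x y :
  cobound (conv f f') (conv g g') x y = conv2 (cobound f g) (cobound f' g') x y.
Proof.
have e := @ext_mul_bilinear k H R; have c := @comp_mul_bilinear k H R.
apply: bilinear_ext_coalg => [||n m n' m' mm mm'].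
- exact: cobound_bilinear.
- exact: conv2_bilinear (cobound_bilinear _ _) (cobound_bilinear _ _).
rewrite !(ev2_mx_conv mm mm') //; try exact: cobound_bilinear.
rewrite ev2_mx_ext // ev2_mx_mul // -!mulmxA; congr (_ *m _); rewrite !mulmxA.
by rewrite (ev2_mxC mm mm' coH (e f' f') (c g)).
Qed.

Lemma coboundV_conv f g f' g' x y :
  coboundV (conv f f') (conv g g') x y =
  conv2 (coboundV f g) (coboundV f' g') x y.
Proof.
have e := @ext_mul_bilinear k H R; have c := @comp_mul_bilinear k H R.
apply: bilinear_ext_coalg => [||n m n' m' mm mm'].
- exact: coboundV_bilinear.
- exact: conv2_bilinear (coboundV_bilinear _ _) (coboundV_bilinear _ _).
rewrite !(ev2_mx_conv mm mm') //; try exact: coboundV_bilinear.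
rewrite ev2_mx_ext // ev2_mx_mul // -!mulmxA; congr (_ *m _); rewrite !mulmxA.
by rewrite (ev2_mxC mm mm' coH (c f') (e g g)).
Qed.

End Fixed.

Section Morphism.
Variables (R R' : comAlgType k) (F : {lrmorphism R -> R'}).

Lemma conv_morph (f g : {linear H -> R}) (f' g' : {linear H -> R'}) x :
  (forall x, F (f x) = f' x) -> (forall x, F (g x) = g' x) ->
  F (conv f g x) = conv f' g' x.
Proof.
move=> ff gg; rewrite /= /sweedler /tlift /fsum linear_sum.
by apply: eq_bigr => p _; rewrite -ff -gg -rmorphM.
Qed.

Lemma conv2_morph (f g : H -> H -> R) (f' g' : H -> H -> R') x y :
  (forall x y, F (f x y) = f' x y) -> (forall x y, F (g x y) = g' x y) ->
  F (conv2 f g x y) = conv2 f' g' x y.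
Proof.
move=> ff gg; rewrite /conv2 /sweedler /tlift /fsum linear_sum.
apply: eq_bigr => p _; rewrite linear_sum; apply: eq_bigr => q _.
by rewrite -ff -gg -rmorphM.
Qed.

Lemma cobound_morph (f g : {linear H -> R}) (f' g' : {linear H -> R'}) x y :
  (forall x, F (f x) = f' x) -> (forall x, F (g x) = g' x) ->
  F (cobound f g x y) = cobound f' g' x y.
Proof.
by move=> ff gg; apply: conv2_morph => u v //; rewrite -!ff -rmorphM.
Qed.

Lemma coboundV_morph (f g : {linear H -> R}) (f' g' : {linear H -> R'}) x y :
  (forall x, F (f x) = f' x) -> (forall x, F (g x) = g' x) ->
  F (coboundV f g x y) = coboundV f' g' x y.
Proof.
by move=> ff gg; apply: conv2_morph => u v //; rewrite -!gg -rmorphM.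
Qed.

Lemma conv_inverse_morph (f g : {linear H -> R}) (f' g' : {linear H -> R'}) :
  (forall x, F (f x) = f' x) -> (forall x, F (g x) = g' x) ->
  conv_inverse f g -> conv_inverse f' g'.
Proof.
move=> ff gg fg x; have := congr1 F (fg x); rewrite linearZ_LR rmorph1 => <-.
rewrite /sweedler /tlift /fsum linear_sum; apply: eq_bigr => p _.
by rewrite -ff -gg -rmorphM.
Qed.

End Morphism.

End Coboundary.

(** * The Hopf algebra generated by the generic point *)

Section ThetaHopf.
Variables (k : fieldType) (H : hopfAlgType k) (tinv : {linear H -> FracSym H}).
Hypotheses (tinvP : is_tgen_inverse tinv) (coH : cocommutative H).
Notation A := (STheta tinv).
Notation t := (tL tinv).
Notation tV := (tVL tinv).
Let T := talg A.

Lemma STheta_domain (a b : A) : a * b = 0 -> a = 0 \/ b = 0.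
Proof.
move=> /(congr1 val) /eqP; rewrite /= mulf_eq0 => /orP[]/eqP e; [left|right];
exact: val_inj.
Qed.

(** Algebra maps preserve convolution inverses, and these are unique. *)
Lemma lift_tV (R : comAlgType k) (F : {lrmorphism A -> R})
    (f g : {linear H -> R}) :
  conv_inverse f g -> (forall x, F (t x) = f x) -> forall x, F (tV x) = g x.
Proof.
move=> fg Ff.
have e : F \o tV =1 g.
  apply: linear_ext_coalg => n m mm.
  have ftV : conv_inverse f (F \o tV).
    by apply: (conv_inverse_morph (F := F)) (t_tV_inverse tinvP).
  have := ev_mx_inverse mm ftV.
  move/(congr1 (mulmx (ev_mx m g))); rewrite mulmxA.
  by rewrite (mulmx1C (ev_mx_inverse mm fg)) mul1mx mulmx1.
exact: e.
Qed.

Lemma sigmaE x y : sigma tinv x y = cobound t tV x y.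
Proof. by []. Qed.

Lemma sigmaVE x y : sigmaV tinv x y = coboundV t tV x y.
Proof.
rewrite /sigmaV /coboundV /conv2 /sweedler /tlift /fsum.
by apply: eq_bigr => p _; apply: eq_bigr => q _; rewrite -mulrA.
Qed.

Definition inlt : {linear H -> T} := @inl_alg k A \o t.
Definition inltV : {linear H -> T} := @inl_alg k A \o tV.
Definition inrt : {linear H -> T} := @inr_alg k A \o t.
Definition inrtV : {linear H -> T} := @inr_alg k A \o tV.

(** For a multiplicative matrix [m], each row of the matrix of the [t (m i
    j)] spans a subcomodule whose coefficients are the [t (m i j)]
    themselves; likewise for [t^-1]. These elements generate the algebra. *)
Lemma STheta_in_subcomodule (rho rhoV : {lrmorphism A -> talg A}) :
  (forall x, rho (t x) = conv inlt inrt x) ->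
  (forall x, rho (tV x) = conv inltV inrtV x) ->
  (forall x, rhoV (t x) = conv inlt inrtV x) ->
  (forall x, rhoV (tV x) = conv inltV inrt x) ->
  forall a, in_subcomodule rho rhoV [:: a].
Proof.
move=> rt rtV rVt rVtV.
have key (f g : {linear H -> A}) :
    conv_inverse f g ->
    (forall x, rho (f x) = conv (@inl_alg k A \o f) (@inr_alg k A \o f) x) ->
    (forall x, rhoV (f x) = conv (@inl_alg k A \o f) (@inr_alg k A \o g) x) ->
    forall x, in_subcomodule rho rhoV [:: f x].
  move=> fg rf rVf x; have [n [m [a [mm ->]]]] := matrix_coalg_span x.
  rewrite pair_bigA (linear_sum f).
  under eq_bigr => p _ do rewrite linearZ_LR.
  apply: in_subcomodule_comb => -[i j] /=.
  exists 'I_n, (fun l => f (m i l)), (fun l h => f (m l h)),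
    (fun l h => g (m l h)).
  split=> [l h|l|l|b].
  - have /matrixP/(_ l h) := ev_mx_inverse mm fg; rewrite !mxE => <-.
    by apply: eq_bigr => p _; rewrite !mxE.
  - rewrite rf [LHS](sweedler_sum (mul_bilinear _ _) (mm.1 i l)).
    by apply: eq_bigr => p _; rewrite /= pure_inl_inr.
  - rewrite rVf [LHS](sweedler_sum (mul_bilinear _ _) (mm.1 i l)).
    by apply: eq_bigr => p _; rewrite /= pure_inl_inr.
  rewrite inE => /eqP ->; exists (fun l => (j == l)%:R).
  by rewrite sum_delta.
elim/subalg_ind=> [|c u v|u v|g [] x].
- exact: in_subcomodule1.
- exact: in_subcomoduleP.
- exact: in_subcomoduleM.
- exact: (key t tV (t_tV_inverse tinvP) rt rVt).
- exact: (key tV t (tV_t_inverse tinvP) rtV rVtV).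
Qed.

Lemma inl_inverse : conv_inverse inlt inltV.
Proof.
by apply: (conv_inverse_morph (F := @inl_alg k A)) (t_tV_inverse tinvP).
Qed.
Lemma inr_inverse : conv_inverse inrt inrtV.
Proof.
by apply: (conv_inverse_morph (F := @inr_alg k A)) (t_tV_inverse tinvP).
Qed.
Lemma inrV_inverse : conv_inverse inrtV inrt.
Proof.
by apply: (conv_inverse_morph (F := @inr_alg k A)) (tV_t_inverse tinvP).
Qed.

Lemma counit_inverse : conv_inverse (counit : {linear H -> k^o}) counit.
Proof.
apply: conv_inverseP => n m mm.
suff -> : ev_mx m (counit : H -> k^o) = 1%:M by rewrite mulmx1.
by apply/matrixP=> i j; rewrite !mxE mm.2.
Qed.

(** The tensor square has two generic points, the images of [t] in both
    factors. Their convolution product defines the comultiplication [rho],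
    the product of the first with the inverse of the second defines [rhoV],
    the counit of [H] defines [eps] and [t^-1] the antipode [S]. The Hopf
    algebra identities need only be checked on [t], where they are
    identities of convolution. *)
Theorem STheta_faithfully_flat : faithfully_flat (STheta_over_BH tinv).
Proof.
have lr_inverse := conv_inverse_conv coH inl_inverse inr_inverse.
have lrV_inverse := conv_inverse_conv coH inl_inverse inrV_inverse.
have [rho rt] := STheta_lift tinvP lr_inverse.
have [rhoV rVt] := STheta_lift tinvP lrV_inverse.
have [eps et] := STheta_lift tinvP counit_inverse.
have [S St] := STheta_lift tinvP (tV_t_inverse tinvP).
have rtV := lift_tV lr_inverse rt.
have rVtV := lift_tV lrV_inverse rVt.
have StV := lift_tV (tV_t_inverse tinvP) St.
have sig_in x y : sigma tinv x y \in subalg_gen (@base_gen _ _ tinv).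
  exact: mem_subalg_gen (Base_sigma _ _ _).
have sigV_in x y : sigmaV tinv x y \in subalg_gen (@base_gen _ _ tinv).
  exact: mem_subalg_gen (Base_sigmaV _ _ _).
have span (P : {pred A}) (F G : H -> H -> A) x y : (forall x y, F x y \in
    subalg_gen (@base_gen _ _ tinv)) -> (forall x y, G x y \in P) ->
    pure_span (subalg_gen (@base_gen _ _ tinv)) P
      (conv2 (fun x y => inl_alg (F x y)) (fun x y => inr_alg (G x y)) x y).
  move=> hF hG; rewrite /conv2 /sweedler /tlift /fsum.
  apply: pure_span_sum => p; apply: pure_span_sum => q.
  by rewrite -pure_inl_inr; apply: pure_span_pure.
have morph_funext (i : {lrmorphism A -> T}) (f g : {linear H -> T})
    (u v : {linear H -> A}) :
    (forall x, i (u x) = f x) -> (forall x, i (v x) = g x) ->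
    cobound f g = (fun x y => i (cobound u v x y)).
  move=> iu iv; apply/funext => x; apply/funext => y.
  by rewrite (cobound_morph x y iu iv).
have morphV_funext (i : {lrmorphism A -> T}) (f g : {linear H -> T})
    (u v : {linear H -> A}) :
    (forall x, i (u x) = f x) -> (forall x, i (v x) = g x) ->
    coboundV f g = (fun x y => i (coboundV u v x y)).
  move=> iu iv; apply/funext => x; apply/funext => y.
  by rewrite (coboundV_morph x y iu iv).
apply: (@hopf_subalgebra_faithfully_flat k A (@base_gen _ _ tinv) STheta_domain
  rho rhoV eps S) => [a|a|a|g [] x y|g [] x y|g [] x y|a].
- have e : copair (scalar_alg eps) idfun \o rho =1 idfun.
    apply: STheta_ext => // x; rewrite /= rt.
    rewrite (conv_morph (f' := scalar_alg eps \o t) (g' := t)); last 2 first.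
    - by move=> y; rewrite [LHS]copair_inl.
    - by move=> y; rewrite [LHS]copair_inr.
    by apply: conv_counit => y; rewrite /= et.
  exact: e.
- have e : copair idfun S \o rho =1 scalar_alg eps.
    apply: STheta_ext => // x; rewrite /= rt et.
    rewrite (conv_morph (f' := t) (g' := tV)); last 2 first.
    - by move=> y; rewrite [LHS]copair_inl.
    - by move=> y; rewrite [LHS]copair_inr St.
    exact: t_tV_inverse.
  exact: e.
- have e : copair rho (@inr_alg k A) \o rhoV =1 @inl_alg k A.
    apply: STheta_ext => // x; rewrite /= rVt.
    rewrite (conv_morph (f' := conv inlt inrt) (g' := inrtV)); last 2 first.
    - by move=> y; rewrite [LHS]copair_inl rt.
    - by move=> y; rewrite [LHS]copair_inr.
    exact: conv_cancel inr_inverse x.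
  exact: e.
- rewrite sigmaE (cobound_morph x y rt rtV) cobound_conv //.
  rewrite (morph_funext (@inl_alg k A) inlt inltV t tV) //.
  rewrite (morph_funext (@inr_alg k A) inrt inrtV t tV) //.
  exact: span.
- rewrite sigmaVE (coboundV_morph x y rt rtV) coboundV_conv //.
  rewrite (morphV_funext (@inl_alg k A) inlt inltV t tV) //.
  rewrite (morphV_funext (@inr_alg k A) inrt inrtV t tV) //.
  by apply: span => u v; rewrite -sigmaVE.
- rewrite sigmaE (cobound_morph x y rVt rVtV) cobound_conv //.
  rewrite (morph_funext (@inl_alg k A) inlt inltV t tV) //.
  rewrite (morph_funext (@inr_alg k A) inrtV inrt tV t) //.
  exact: span.
- rewrite sigmaVE (coboundV_morph x y rVt rVtV) coboundV_conv //.
  rewrite (morphV_funext (@inl_alg k A) inlt inltV t tV) //.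
  rewrite (morphV_funext (@inr_alg k A) inrtV inrt tV t) //.
  by apply: span => u v //; rewrite -sigmaVE.
- by rewrite sigmaE (cobound_morph x y St StV) coboundC // -sigmaVE.
- by rewrite sigmaVE (coboundV_morph x y St StV) -coboundC // -sigmaE.
- exact: STheta_in_subcomodule.
Qed.

End ThetaHopf.

Theorem theorem3p8 (k : fieldType) (H : hopfAlgType k)
    (tinv : {linear H -> FracSym H}) :
  is_tgen_inverse tinv ->
  cocommutative H ->
  faithfully_flat (STheta_over_BH tinv).
Proof. exact: STheta_faithfully_flat. Qed.
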